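(* Let $m>3$ be a real number, put $t=\frac{m}{m+1}$ and $\Delta_\sigma=\frac{m-2}{2(m+1)}$ (so $\frac18<\Delta_\sigma<\frac12$), and let $$G(z,\bar z)=G_{(1,1)}(z)\,G_{(1,1)}(\bar z)+C\,G_{(1,3)}(z)\,G_{(1,3)}(\bar z),\qquad C=\gamma(t)\,\gamma(3t-1)\,\gamma(1-2t)\,\gamma(2-2t),$$ where $G_{(1,1)}$, $G_{(1,3)}$ and $\gamma$ are as defined in the context. Then all coefficients in the expansion of $G(z,\bar z)$ into products of global ($\mathfrak{sl}(2)$) conformal blocks are non-negative. That is, in the unique expansion $$G(z,\bar z)=\sum_{n,\bar n\ge 0} p_{n,\bar n}\,K_{n}(z)K_{\bar n}(\bar z)+\sum_{n,\bar n\ge 0} q_{n,\bar n}\,K_{h+n}(z)K_{h+\bar n}(\bar z),\qquad h=\frac{1+4\Delta_\sigma}{3},$$ one has $p_{n,\bar n}\ge 0$ and $q_{n,\bar n}\ge 0$ for all integers $n,\bar n\ge 0$.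
   Context: Here $z$ and $\bar z$ are treated as independent variables and expansions are understood as (generalized) power series around $z=\bar z=0$, convergent for $0<z,\bar z<1$. Notation: $\gamma(x)=\Gamma(x)/\Gamma(1-x)$; the global block is $K_a(z)=z^a\,{}_2F_1(a,a;2a;z)$, with the convention $K_0(z)=1$. The Virasoro blocks are $$G_{(1,1)}(z)=(1-z)^{-\Delta_\sigma}\,{}_2F_1\!\left(-2\Delta_\sigma,\tfrac{1-2\Delta_\sigma}{3};\tfrac{2-4\Delta_\sigma}{3};z\right),$$ $$G_{(1,3)}(z)=z^{\frac{1+4\Delta_\sigma}{3}}(1-z)^{-\Delta_\sigma}\,{}_2F_1\!\left(\tfrac{1-2\Delta_\sigma}{3},\tfrac{2+2\Delta_\sigma}{3};\tfrac{4+4\Delta_\sigma}{3};z\right).$$ (The function $G(z,\bar z)$ is the four-point function $\langle\sigma\sigma\sigma\sigma\rangle$, stripped of its kinematic prefactor, of the field $\sigma=\phi_{1,2}$ in the generalized minimal model with central charge $c=1-\frac{6}{m(m+1)}$.) *)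

(* Defs.v *)
From Stdlib Require Import Reals Factorial.
From Coquelicot Require Import Coquelicot.
Open Scope R_scope.

Fixpoint pochhammer (a : R) (n : nat) : R :=
  match n with
  | O => 1
  | S k => pochhammer a k * (a + INR k)
  end.

(* Gauss's hypergeometric series, meaningful for [Rabs z < 1] and [c] not in
   {0, -1, -2, ...}. *)
Definition hyp2F1 (a b c z : R) : R :=
  PSeries (fun k => pochhammer a k * pochhammer b k
                    / (pochhammer c k * INR (fact k))) z.

(* Euler's limit n! n^x / (x (x+1) ... (x+n)), which gives the Gamma function
   on all of R except the poles 0, -1, -2, ...; the value there is junk. *)
Definition Gamma (x : R) : R :=
  real (Lim_seq (fun n => INR (fact n) * Rpower (INR n) x
                          / pochhammer x (S n))).

Definition gamma_ratio (x : R) : R := Gamma x / Gamma (1 - x).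

(* Global sl(2) block. At [a = 0] the hypergeometric series 2F1(0,0;0;z) is
   undefined, so K_0 = 1 is imposed by convention. *)
Definition global_block (a z : R) : R :=
  if Req_EM_T a 0 then 1 else Rpower z a * hyp2F1 a a (2 * a) z.

Definition G11 (Delta z : R) : R :=
  Rpower (1 - z) (- Delta)
  * hyp2F1 (- 2 * Delta) ((1 - 2 * Delta) / 3) ((2 - 4 * Delta) / 3) z.

Definition G13 (Delta z : R) : R :=
  Rpower z ((1 + 4 * Delta) / 3) * Rpower (1 - z) (- Delta)
  * hyp2F1 ((1 - 2 * Delta) / 3) ((2 + 2 * Delta) / 3) ((4 + 4 * Delta) / 3) z.

Definition four_point (Delta C z zb : R) : R :=
  G11 Delta z * G11 Delta zb + C * (G13 Delta z * G13 Delta zb).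

(* The double series of [a] converges absolutely (hence unconditionally), with
   sum [s]. *)
Definition is_double_series (a : nat -> nat -> R) (s : R) : Prop :=
  (forall n, ex_series (fun k => Rabs (a n k)))
  /\ ex_series (fun n => Series (fun k => Rabs (a n k)))
  /\ Series (fun n => Series (a n)) = s.

(* [F] expands on (0,1) x (0,1) into products of global blocks, with
   coefficients [p] for the weights (n, k) and [q] for (h + n, h + k). As
   K_a(z) is z^a times a power series with non-negative coefficients (a >= 0),
   absolute convergence here is the same as absolute convergence of the
   underlying generalized power series in z and zb. *)
Definition block_expansion (h : R) (F : R -> R -> R) (p q : nat -> nat -> R)
  : Prop :=
  forall z zb : R, 0 < z < 1 -> 0 < zb < 1 ->
  exists s s' : R,
    is_double_series
      (fun n k => p n k * (global_block (INR n) z * global_block (INR k) zb)) s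
    /\ is_double_series
      (fun n k => q n k * (global_block (h + INR n) z
                           * global_block (h + INR k) zb)) s'
    /\ F z zb = s + s'.

(* Main.v *)
Require Import Defs.
From Stdlib Require Import Reals Factorial Wf_nat Lra Lia.
From Coquelicot Require Import Coquelicot.
Open Scope R_scope.

(** Put [d = Delta], [b = (1 - 2 d) / 3] (so [0 < b < 1/4]) and let [s] be [0]
    or [h = 1 - 2 b]. Both Virasoro blocks solve one second-order equation
    [E f = 0], with exponents [0] and [h] at [z = 0]. The operators
    [X = 1/z - 1/2] and [Y = (1 - z) d/dz] act on global blocks by
    [X K_p = K_(p-1) + c_p K_(p+1)] and [Y K_p = p K_(p-1) + (1 - p) c_p K_(p+1)]
    with [c_p = p^2 / (4 (4 p^2 - 1))], and with the Casimir operator [D],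
    [D K_p = p (p - 1) K_p], one has
    [E = (X^2 - 1/4) D + 2 b X Y - (1 - 3 b) (1 - b) / 4].
    So [E K_p] is a combination of [K_(p-2)], [K_p], [K_(p+2)], and the
    coefficients [a_m] of [K_(s+2m)] obey a three-term recurrence. Comparing
    [a_(m+1) / a_m] with an explicit rational function of [p = s + 2 m] shows
    that they are positive; Tonelli then justifies the rearrangement. The
    expansion of the four-point function is the product expansion, and
    [C >= 0] because two of its four factors are [<= 0]. Uniqueness comes from
    comparing leading powers as [z -> 0], first in [z], then in [zb]; it needs
    [0 < h < 1]. *)

(** * Coefficients of the block expansion and their positivity *)

Definition cc (p : R) : R := p * p / (4 * ((2 * p - 1) * (2 * p + 1))).

(* [E K_p = coefA K_(p-2) + coefB K_p + coefC K_(p+2)]. *)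
Definition coefA (b p : R) : R := p * (p - 1 + 2 * b).
Definition coefB (b p : R) : R :=
  p * (p - 1) * (cc p + cc (p - 1) - / 4)
  + 2 * b * (p * cc (p - 1) + (1 - p) * cc p) - (1 - 3 * b) * (1 - b) / 4.
Definition coefC (b p : R) : R := cc p * cc (p + 1) * (p - 1) * (p - 2 * b).

(** The pair is (a_m, a_(m+1)), which makes the two-step recurrence structural. The recurrence says
    that the coefficient of K_p in E applied to the sum of a_m K_(s+2m) vanishes; the seed a_1 comes
    from the coefficient of K_s. *)
Fixpoint casimir_pair (b s : R) (m : nat) : R * R :=
  match m with
  | O => (1, - coefB b s / coefA b (s + 2))
  | S k =>
      let (x, y) := casimir_pair b s k in
      let p := s + 2 * INR (S k) in
      (y, (- coefB b p * y - coefC b (p - 2) * x) / coefA b (p + 2))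
  end.

Definition block_coef (b s : R) (m : nat) : R := fst (casimir_pair b s m).

Lemma block_coef_0 b s : block_coef b s 0 = 1.
Proof. reflexivity. Qed.

Lemma block_coef_1 b s : block_coef b s 1 = - coefB b s / coefA b (s + 2).
Proof. reflexivity. Qed.

Lemma block_coef_SS b s m :
  let p := s + 2 * INR (S m) in
  block_coef b s (S (S m)) =
  (- coefB b p * block_coef b s (S m) - coefC b (p - 2) * block_coef b s m)
  / coefA b (p + 2).
Proof.
  unfold block_coef. cbn [casimir_pair].
  destruct (casimir_pair b s m) as [x y]. reflexivity.
Qed.

(* Both solutions of the recurrence have ratio [(1 - x/p + ...) / 16], with
   [x = 3 - 4 d] for the dominant one and [x = 5 - 2 b] for the other; [rho] has
   [x = 17/4], strictly between. *)
Definition rho (p : R) : R :=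
  p * (p + 1) * (4 * p - 5) / (16 * ((2 * p - 1) * (2 * p + 1) * (p + 4))).

Lemma rho_pos p : 2 <= p -> 0 < rho p.
Proof.
  intros Hp; unfold rho; apply Rdiv_lt_0_compat; repeat apply Rmult_lt_0_compat; lra.
Qed.

Lemma rho_base b p : 0 < b < / 4 -> 2 <= p -> coefA b (p + 2) * rho p <= - coefB b p.
Proof.
  intros Hb Hp.
  (* Taylor expansion of the numerator at p = 2: each coefficient is a polynomial in b of degree at
     most two, non-negative on 0 < b < 1/4. *)
  assert (E : - coefB b p - coefA b (p + 2) * rho p =
    (let q := p - 2 in
      (432 - 1872 * b + 1080 * b ^ 2) + (1674 - 5964 * b + 3492 * b ^ 2) * q ^ 1
      + (2133 - 5686 * b + 3144 * b ^ 2) * q ^ 2 + (1402 - 2114 * b + 1008 * b ^ 2) * q ^ 3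
      + (541 - 308 * b + 96 * b ^ 2) * q ^ 4 + (110 - 16 * b) * q ^ 5 + 8 * q ^ 6)
    / (16 * ((2 * p - 3) * (2 * p - 1) * (2 * p + 1) * (p + 4)))).
  { unfold coefA, coefB, cc, rho; cbv zeta; field; lra. }
  apply Rminus_le_0; rewrite E.
  assert (Hq : 0 <= p - 2) by lra.
  apply Rdiv_le_0_compat; [cbv zeta | repeat apply Rmult_lt_0_compat; lra].
  repeat match goal with |- 0 <= _ + _ * (p - _) ^ _ =>
    apply Rplus_le_le_0_compat; [|apply Rmult_le_pos; [|apply pow_le; lra]] end; nra.
Qed.

(** If one ratio is at least [rho (p - 2)], the recurrence bounds the next one below by (- coefB p -
    coefC (p-2) / rho (p-2)) / coefA (p+2). That this is at least [rho p] is the inequality here,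
    cleared of denominators. The numerator is expanded at p = 4. *)
Lemma rho_step b p : 0 < b < / 4 -> 4 <= p ->
  coefA b (p + 2) * rho p * rho (p - 2) <= - coefB b p * rho (p - 2) - coefC b (p - 2).
Proof.
  intros Hb Hp.
  assert (E : - coefB b p * rho (p - 2) - coefC b (p - 2) - coefA b (p + 2) * rho p * rho (p - 2) =
    (p - 2) * (p - 1) *
    (let q := p - 4 in
      (25704 - 93744 * b + 90720 * b ^ 2) + (72738 - 236532 * b + 214668 * b ^ 2) * q ^ 1
      + (55923 - 173782 * b + 159432 * b ^ 2) * q ^ 2
      + (17274 - 53966 * b + 51312 * b ^ 2) * q ^ 3
      + (2163 - 7364 * b + 7392 * b ^ 2) * q ^ 4 + (78 - 352 * b + 384 * b ^ 2) * q ^ 5)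
    / (256 * ((2 * p - 5) * ((2 * p - 3) * (2 * p - 3)) * (2 * p - 1) * (2 * p + 1) * (p + 2) * (p + 4)))).
  { unfold coefA, coefB, coefC, cc, rho; cbv zeta; field; lra. }
  apply Rminus_le_0; rewrite E.
  assert (Hq : 0 <= p - 4) by lra.
  apply Rdiv_le_0_compat; [cbv zeta | repeat apply Rmult_lt_0_compat; lra].
  apply Rmult_le_pos; [nra|].
  repeat match goal with |- 0 <= _ + _ * (p - _) ^ _ =>
    apply Rplus_le_le_0_compat; [|apply Rmult_le_pos; [|apply pow_le; lra]] end; nra.
Qed.

Lemma coefA_pos b p : 0 < b -> 1 <= p -> 0 < coefA b p.
Proof. intros; unfold coefA; nra. Qed.

Lemma coefC_nonneg b p : 0 < b < / 4 -> 2 <= p -> 0 <= coefC b p.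
Proof.
  intros; unfold coefC, cc.
  repeat apply Rmult_le_pos; try lra; apply Rlt_le, Rinv_0_lt_compat; nra.
Qed.

Definition admissible (b s : R) : Prop := 0 < b < / 4 /\ (s = 0 \/ s = 1 - 2 * b).

Lemma admissible_bounds b s : admissible b s -> 0 < b < / 4 /\ 0 <= s < 1.
Proof. intros [Hb [-> | ->]]; lra. Qed.

(** For s = 0 the factor [cc 0] vanishes; for s = 1 - 2b the last two factors are -2b < 0 and 1 - 4b
    > 0. This is opposite to the sign at weights p >= 2. *)
Lemma coefC_first b s : admissible b s -> coefC b s <= 0.
Proof.
  intros [Hb [-> | ->]]; unfold coefC, cc.
  - right; field.
  - assert (0 <= (1 - 2 * b) * (1 - 2 * b) / (4 * ((2 * (1 - 2 * b) - 1) * (2 * (1 - 2 * b) + 1))) *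
      ((1 - 2 * b + 1) * (1 - 2 * b + 1) /
      (4 * ((2 * (1 - 2 * b + 1) - 1) * (2 * (1 - 2 * b + 1) + 1))))).
    { repeat apply Rmult_le_pos; try lra; apply Rlt_le, Rinv_0_lt_compat; nra. }
    rewrite Rmult_assoc.
    assert ((1 - 2 * b - 1) * (1 - 2 * b - 2 * b) <= 0) by nra. nra.
Qed.

(** This is what makes a_1 positive. *)
Lemma coefB_first b s : admissible b s -> coefB b s < 0.
Proof.
  intros [Hb [-> | ->]]; unfold coefB, cc.
  - replace (0 * 0) with 0 by ring. unfold Rdiv. rewrite !Rmult_0_l. nra.
  - match goal with |- ?x < 0 => replace x with
      (- ((1 - 4 * b) * (1 - b) * (3 - 5 * b) / (4 * (3 - 4 * b)))) by (field; lra) end.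
    apply Ropp_lt_gt_0_contravar, Rdiv_lt_0_compat; [|lra].
    repeat apply Rmult_lt_0_compat; lra.
Qed.

(** Positivity alone is not inductive, because [- coefC] is non-positive at weights p >= 2; the
    lower bound on the ratio controls that term. The bound starts at a_2 / a_1, as [rho] is meant
    for p >= 2 only. *)
Lemma block_coef_ratio b s m : admissible b s ->
  0 < block_coef b s m /\ 0 < block_coef b s (S m) /\
  rho (s + 2 * INR (S m)) * block_coef b s (S m) <= block_coef b s (S (S m)).
Proof.
  intros Has. destruct (admissible_bounds _ _ Has) as [Hb Hs].
  assert (Hdiv : forall n x,
    let p := s + 2 * INR (S n) in
    coefA b (p + 2) * (rho p * block_coef b s (S n)) <= x ->
    rho p * block_coef b s (S n) <= x / coefA b (p + 2)).
  { intros n x p Hx. assert (0 < coefA b (p + 2)).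
    { apply coefA_pos; [lra|]. pose proof (pos_INR (S n)); unfold p; lra. }
    apply (proj1 (Rle_div_r _ _ _ H)). lra. }
  induction m as [|m IH].
  - assert (H1 : 0 < block_coef b s 1).
    { rewrite block_coef_1. pose proof (coefB_first b s Has).
      apply Rdiv_lt_0_compat; [lra|]. apply coefA_pos; lra. }
    split; [rewrite block_coef_0; lra|]. split; [assumption|].
    rewrite block_coef_SS; cbv zeta. apply Hdiv.
    rewrite block_coef_0. replace (s + 2 * INR 1 - 2) with s by (simpl; ring).
    pose proof (coefC_first b s Has).
    assert (Hp : 2 <= s + 2 * INR 1) by (simpl; lra).
    pose proof (rho_base b _ Hb Hp). nra.
  - destruct IH as [H0 [H1 H2]].
    assert (Hp : 4 <= s + 2 * INR (S (S m))).
    { rewrite !S_INR; pose proof (pos_INR m); lra. }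
    assert (Ep : s + 2 * INR (S m) = s + 2 * INR (S (S m)) - 2) by (rewrite !S_INR; ring).
    assert (Hr : 0 < rho (s + 2 * INR (S (S m)) - 2)) by (apply rho_pos; lra).
    rewrite Ep in H2.
    assert (H3 : 0 < block_coef b s (S (S m))) by nra.
    split; [assumption|]. split; [assumption|].
    rewrite (block_coef_SS b s (S m)); cbv zeta. apply Hdiv.
    set (p := s + 2 * INR (S (S m))) in *.
    pose proof (rho_step b p Hb Hp) as Hstep.
    assert (HC : 0 <= coefC b (p - 2)) by (apply coefC_nonneg; lra).
    set (x := block_coef b s (S m)) in *. set (y := block_coef b s (S (S m))) in *.
    (* After multiplication by [rho (p - 2)], the induction hypothesis replaces [rho (p - 2) * x] by
       the larger [y] in the [coefC] term, and [rho_step] scaled by [y] finishes. *)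
    apply Rmult_le_reg_l with (rho (p - 2)); [assumption|].
    assert (coefC b (p - 2) * (rho (p - 2) * x) <= coefC b (p - 2) * y)
      by (apply Rmult_le_compat_l; assumption).
    assert (y * (coefA b (p + 2) * rho p * rho (p - 2))
            <= y * (- coefB b p * rho (p - 2) - coefC b (p - 2)))
      by (apply Rmult_le_compat_l; lra).
    lra.
Qed.

Lemma block_coef_pos b s m : admissible b s -> 0 < block_coef b s m.
Proof. intros H; apply (block_coef_ratio b s m H). Qed.

(** * The differential equation acting on a global block *)

Lemma pochhammer_pos a n : 0 < a -> 0 < pochhammer a n.
Proof.
  intros Ha; induction n as [|n IH]; simpl; [lra|].
  apply Rmult_lt_0_compat; [assumption|]. pose proof (pos_INR n); lra.
Qed.

Lemma pochhammer_nonneg a n : 0 <= a -> 0 <= pochhammer a n.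
Proof.
  intros Ha; induction n as [|n IH]; simpl; [lra|].
  apply Rmult_le_pos; [assumption|]. pose proof (pos_INR n); lra.
Qed.

Lemma pochhammer_Sl a n : pochhammer a (S n) = a * pochhammer (a + 1) n.
Proof.
  induction n as [|n IH]; [simpl; ring|].
  cbn [pochhammer] in *. rewrite IH, S_INR. cbn [pochhammer]. ring.
Qed.

Definition hyp_coef (a b c : R) (k : nat) : R :=
  pochhammer a k * pochhammer b k / (pochhammer c k * INR (fact k)).

Definition kc (p : R) : nat -> R := hyp_coef p p (2 * p).

(** The denominator vanishes here too, but the numerator has a factor 0, so the quotient is 0 and
    [kc 0] agrees with the convention K_0 = 1. *)
Lemma kc_zero_l j : kc 0 (S j) = 0.
Proof.
  unfold kc, hyp_coef. rewrite (pochhammer_Sl 0). unfold Rdiv. ring.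
Qed.

Lemma kc_0 p : kc p 0 = 1.
Proof. unfold kc, hyp_coef; simpl; field. Qed.

Lemma kc_nonneg p j : 0 <= p -> 0 <= kc p j.
Proof.
  intros [Hp | <-].
  - unfold kc, hyp_coef. apply Rdiv_le_0_compat.
    + apply Rmult_le_pos; apply pochhammer_nonneg; lra.
    + apply Rmult_lt_0_compat; [apply pochhammer_pos; lra|apply INR_fact_lt_0].
  - destruct j; [rewrite kc_0; lra | rewrite kc_zero_l; lra].
Qed.

(** Multiplication by z on coefficient sequences. *)
Definition shift (u : nat -> R) (k : nat) : R := match k with O => 0 | S n => u n end.

(* Coefficient of [z^(s+k)] in [z^2 E (z^s u(z))]. *)
Definition frob (b s : R) (u : nat -> R) (k : nat) : R :=
  (s + INR k) * (s + INR k - 1 + 2 * b) * u k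
  - (s + INR k - 1) * (2 * (s + INR k) - 3 + 3 * b) * shift u k
  + ((s + INR k - 2) * (s + INR k - 2 + b) - (1 - 3 * b) * (1 - b) / 4) * shift (shift u) k.

(* Excludes the weights where a denominator of [cc] or of [K_(p-2)] vanishes. *)
Definition regular (p : R) : Prop := 0 < p /\ 2 * p - 1 <> 0 /\ p - 1 <> 0 /\ 2 * p - 3 <> 0.


(** Writes the coefficients of K_(p-2) through the Pochhammer symbols of p and 2p at J, to make them
    commensurable with those of K_p and K_(p+2). The split at index 4 is where K_(p+2) begins
    relative to K_(p-2). *)
Lemma kc_pred p : regular p ->
  kc (p - 2) 1 = (p - 2) / 2 /\
  kc (p - 2) 2 = (p - 2) * (p - 1) ^ 2 / (4 * (2 * p - 3)) /\
  kc (p - 2) 3 = (p - 2) * (p - 1) * p ^ 2 / (24 * (2 * p - 3)) /\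
  forall J, kc (p - 2) (4 + J) =
    (p - 2) * (p - 1) * (pochhammer p J * (p + INR J) * (p + INR J + 1)) ^ 2
    / (4 * (2 * p - 3) * (2 * p - 1) * pochhammer (2 * p) J
       * ((INR J + 1) * (INR J + 2) * (INR J + 3) * (INR J + 4) * INR (fact J))).
Proof.
  intros [Hp [H1 [H2 H3]]].
  (* At p = 2 the block K_(p-2) is K_0, whose hypergeometric denominators vanish; both sides are
     then 0. *)
  destruct (Req_dec p 2) as [->|N2].
  { replace (2 - 2) with 0 by ring.
    repeat split; intros; cbn [Nat.add]; rewrite kc_zero_l; unfold Rdiv; ring. }
  assert (N4 : 2 * (p - 2) <> 0) by lra.
  assert (E1 : forall k, pochhammer (p - 2) (S (S k)) = (p - 2) * (p - 1) * pochhammer p k).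
  { intros k; rewrite !pochhammer_Sl. replace (p - 2 + 1 + 1) with p by ring. ring. }
  assert (E2 : forall k, pochhammer (2 * (p - 2)) (4 + k) =
    (2 * p - 4) * (2 * p - 3) * (2 * p - 2) * (2 * p - 1) * pochhammer (2 * p) k).
  { intros k; cbn [Nat.add]; rewrite !pochhammer_Sl.
    replace (2 * (p - 2) + 1 + 1 + 1 + 1) with (2 * p) by ring. ring. }
  unfold kc, hyp_coef.
  repeat split.
  - simpl. field. lra.
  - simpl. field. lra.
  - simpl. field. lra.
  - intros J. rewrite E2.
    replace (4 + J)%nat with (S (S (S (S J)))) by lia. rewrite (E1 (S (S J))).
    assert (HF : INR (fact J) <> 0) by apply INR_fact_neq_0.
    assert (HQ : pochhammer (2 * p) J <> 0) by (apply Rgt_not_eq, pochhammer_pos; lra).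
    pose proof (pos_INR J).
    cbn [pochhammer]. rewrite !fact_simpl, !mult_INR, !S_INR.
    field. repeat split; try lra.
Qed.

Lemma kc_succ p J : 0 < p ->
  kc (p + 2) J =
    (pochhammer p J * (p + INR J) * (p + INR J + 1) / (p * (p + 1))) ^ 2
    * (2 * p * (2 * p + 1) * (2 * p + 2) * (2 * p + 3))
    / (pochhammer (2 * p) J * (2 * p + INR J) * (2 * p + INR J + 1)
       * (2 * p + INR J + 2) * (2 * p + INR J + 3) * INR (fact J)).
Proof.
  intros Hp.
  assert (HF : INR (fact J) <> 0) by apply INR_fact_neq_0.
  assert (HQ : pochhammer (2 * p) J <> 0) by (apply Rgt_not_eq, pochhammer_pos; lra).
  pose proof (pos_INR J).
  assert (E1 : pochhammer (p + 2) J = pochhammer p J * (p + INR J) * (p + INR J + 1) / (p * (p + 1))).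
  { assert (E : pochhammer p (S (S J)) = p * (p + 1) * pochhammer (p + 2) J).
    { rewrite !pochhammer_Sl. replace (p + 1 + 1) with (p + 2) by ring. ring. }
    cbn [pochhammer] in E. rewrite S_INR in E.
    apply Rmult_eq_reg_l with (p * (p + 1)); [|nra].
    rewrite <- E. field. lra. }
  assert (E2 : pochhammer (2 * (p + 2)) J = pochhammer (2 * p) J * (2 * p + INR J) * (2 * p + INR J + 1)
       * (2 * p + INR J + 2) * (2 * p + INR J + 3) / (2 * p * (2 * p + 1) * (2 * p + 2) * (2 * p + 3))).
  { assert (E : pochhammer (2 * p) (S (S (S (S J)))) =
      2 * p * (2 * p + 1) * (2 * p + 2) * (2 * p + 3) * pochhammer (2 * (p + 2)) J).
    { rewrite !pochhammer_Sl. replace (2 * p + 1 + 1 + 1 + 1) with (2 * (p + 2)) by ring. ring. }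
    cbn [pochhammer] in E. rewrite !S_INR in E.
    apply Rmult_eq_reg_l with (2 * p * (2 * p + 1) * (2 * p + 2) * (2 * p + 3));
      [|repeat apply Rmult_integral_contrapositive_currified; lra].
    transitivity (pochhammer (2 * p) J * (2 * p + INR J) * (2 * p + (INR J + 1))
      * (2 * p + (INR J + 1 + 1)) * (2 * p + (INR J + 1 + 1 + 1))); [rewrite E; ring|].
    field. repeat split; lra. }
  unfold kc, hyp_coef. rewrite E1, E2. field. repeat split; lra.
Qed.

(** Coefficient of z^(p+j) in z^2 E K_p = z^2 (coefA K_(p-2) + coefB K_p + coefC K_(p+2)); the three
    blocks start at j = 0, 2, 4, hence the shifts. For j >= 4 everything is expressed through
    Pochhammer symbols and factorials at J = j - 4, leaving a rational identity in p, b and J. *)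
Lemma frob_block b p j : regular p ->
  let K := kc p in
  (p + INR j) * (p + INR j - 1 + 2 * b) * K j
  - (p + INR j - 1) * (2 * (p + INR j) - 3 + 3 * b) * shift K j
  + ((p + INR j - 2) * (p + INR j - 2 + b) - (1 - 3 * b) * (1 - b) / 4) * shift (shift K) j
  = coefA b p * kc (p - 2) j + coefB b p * shift (shift K) j
    + coefC b p * shift (shift (shift (shift (kc (p + 2))))) j.
Proof.
  intros Hr; cbv zeta.
  destruct (kc_pred p Hr) as [E1 [E2 [E3 E4]]].
  destruct Hr as [Hp [H1 [H2 H3]]].
  destruct j as [|[|[|[|J]]]].
  - cbn [shift]. rewrite !kc_0. unfold coefA. simpl. ring.
  - cbn [shift]. rewrite !kc_0, E1. unfold coefA, kc, hyp_coef. simpl. field. lra.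
  - cbn [shift]. rewrite !kc_0, E2. unfold coefA, coefB, kc, hyp_coef, cc. simpl. field. lra.
  - cbn [shift]. rewrite E3. unfold coefA, coefB, kc, hyp_coef, cc. simpl. field. lra.
  - cbn [shift]. specialize (E4 J); cbn [Nat.add] in E4. rewrite E4, (kc_succ p J Hp).
    assert (HF : INR (fact J) <> 0) by apply INR_fact_neq_0.
    assert (HQ : pochhammer (2 * p) J <> 0) by (apply Rgt_not_eq, pochhammer_pos; lra).
    pose proof (pos_INR J).
    unfold kc, hyp_coef. cbn [pochhammer]. rewrite !fact_simpl, !mult_INR, !S_INR.
    unfold coefA, coefB, coefC, cc.
    set (P := pochhammer p J) in *. set (Q := pochhammer (2 * p) J) in *.
    set (F := INR (fact J)) in *. set (x := INR J) in *. clearbody P Q F x.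
    field. repeat split; lra.
Qed.

Lemma shift_ext u v : (forall k, u k = v k) -> forall k, shift u k = shift v k.
Proof. intros H [|k]; [reflexivity|apply H]. Qed.

Fixpoint nshift (n : nat) (u : nat -> R) : nat -> R :=
  match n with O => u | S m => shift (nshift m u) end.

Lemma nshift_lt n u k : (k < n)%nat -> nshift n u k = 0.
Proof.
  revert k; induction n as [|n IH]; intros [|k] H; try lia; [reflexivity|].
  apply (IH k); lia.
Qed.

Lemma nshift_add n u j : nshift n u (n + j) = u j.
Proof. induction n as [|n IH]; [reflexivity|exact IH]. Qed.

(** A factor z can be moved into the prefactor: z^s (z u) = z^(s+1) u. *)
Lemma frob_shift b s u k : frob b s (shift u) k = shift (frob b (s + 1) u) k.
Proof.
  destruct k as [|[|[|k]]]; unfold frob; cbn [shift]; rewrite ?S_INR; simpl INR; ring.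
Qed.

Lemma frob_nshift b s n u k :
  frob b s (nshift n u) k = nshift n (frob b (s + INR n) u) k.
Proof.
  revert s k; induction n as [|n IH]; intros s k.
  - simpl. replace (s + 0) with s by ring. reflexivity.
  - cbn [nshift]. rewrite frob_shift. apply shift_ext; intros j.
    rewrite IH, S_INR.
    replace (s + 1 + INR n) with (s + (INR n + 1)) by ring. reflexivity.
Qed.

(** Power series of K_(s+2m) / z^s: one common prefactor z^s puts all blocks of a family into the
    same space of sequences. *)
Definition block_row (s : R) (m : nat) : nat -> R := nshift (2 * m) (kc (s + 2 * INR m)).

Lemma block_row_lt s m k : (k < 2 * m)%nat -> block_row s m k = 0.
Proof. apply nshift_lt. Qed.

Lemma block_row_nonneg s m k : 0 <= s -> 0 <= block_row s m k.
Proof.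
  intros Hs. destruct (Nat.lt_ge_cases k (2 * m)) as [H|H].
  - rewrite block_row_lt by assumption; lra.
  - unfold block_row. replace k with (2 * m + (k - 2 * m))%nat by lia.
    rewrite nshift_add. apply kc_nonneg. pose proof (pos_INR m); lra.
Qed.

Lemma nshift_shift2 n u k : shift (shift (nshift n u)) k = nshift (S (S n)) u k.
Proof. reflexivity. Qed.

Lemma nshift_comm n u : shift (nshift n u) = nshift n (shift u).
Proof. induction n as [|n IH]; [reflexivity|]. cbn [nshift]. rewrite IH. reflexivity. Qed.

Lemma frob_row_S b s m k : 0 < b < / 4 -> 0 <= s ->
  let p := s + 2 * INR (S m) in
  frob b s (block_row s (S m)) k =
  coefA b p * shift (shift (block_row s m)) k
  + coefB b p * shift (shift (block_row s (S m))) k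
  + coefC b p * shift (shift (block_row s (S (S m)))) k.
Proof.
  intros Hb Hs p. unfold block_row.
  rewrite frob_nshift.
  assert (Ep : s + INR (2 * S m) = p) by (unfold p; rewrite mult_INR; simpl (INR 2); ring).
  rewrite Ep. fold p.
  assert (Hp : 2 <= p) by (unfold p; rewrite S_INR; pose proof (pos_INR m); lra).
  replace (s + 2 * INR m) with (p - 2) by (unfold p; rewrite S_INR; ring).
  replace (s + 2 * INR (S (S m))) with (p + 2) by (unfold p; rewrite !S_INR; ring).
  rewrite nshift_shift2.
  replace (S (S (2 * m))) with (2 * S m)%nat by lia.
  replace (2 * S (S m))%nat with (S (S (2 * S m))) by lia.
  set (n := (2 * S m)%nat).
  change (nshift (S (S n)) (kc (p + 2))) with (shift (shift (nshift n (kc (p + 2))))).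
  rewrite !nshift_comm.
  destruct (Nat.lt_ge_cases k n) as [H|H].
  - rewrite !nshift_lt by assumption; ring.
  - replace k with (n + (k - n))%nat by lia. rewrite !nshift_add.
    unfold frob. rewrite <- frob_block; [ring|]. repeat split; lra.
Qed.

(** No K_(s-2) appears because s is an exponent of the equation, that is [coefA b s = 0]. The weight
    0 is not [regular] and is checked by hand. *)
Lemma frob_row_0 b s k : admissible b s ->
  frob b s (block_row s 0) k =
  coefB b s * shift (shift (block_row s 0)) k + coefC b s * shift (shift (block_row s 1)) k.
Proof.
  intros [Hb Hs]. unfold block_row. simpl (2 * 0)%nat. simpl (2 * 1)%nat.
  cbn [nshift]. simpl (INR 0); simpl (INR 1).
  replace (s + 2 * 0) with s by ring. replace (s + 2 * 1) with (s + 2) by ring.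
  destruct Hs as [-> | ->].
  - replace (coefC b 0) with 0 by (unfold coefC, cc; field).
    replace (coefB b 0) with (- (1 - 3 * b) * (1 - b) / 4) by (unfold coefB, cc; field).
    destruct k as [|[|[|k]]]; unfold frob; cbn [shift]; rewrite ?kc_zero_l, ?kc_0; simpl; field.
  - unfold frob. rewrite frob_block by (repeat split; lra).
    replace (coefA b (1 - 2 * b)) with 0 by (unfold coefA; ring). ring.
Qed.

(** * The summed block series solves the differential equation *)

Definition block_sum (b s : R) (k : nat) : R :=
  sum_f_R0 (fun m => block_coef b s m * block_row s m k) k.

(** Row m starts at z^(2m), so truncating the sum over m at k loses nothing in the coefficient of
    z^k. *)
Lemma block_sum_ge b s N k : (k <= N)%nat ->
  sum_f_R0 (fun m => block_coef b s m * block_row s m k) N = block_sum b s k.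
Proof.
  intros H; induction H as [|N H IH]; [reflexivity|].
  cbn [sum_f_R0]. rewrite IH, block_row_lt by lia. ring.
Qed.

Lemma shift_sum b s N k : (k <= N)%nat ->
  sum_f_R0 (fun m => block_coef b s m * shift (block_row s m) k) N = shift (block_sum b s) k.
Proof.
  destruct k as [|k]; intros H; cbn [shift].
  - clear H; induction N as [|N IH]; cbn [sum_f_R0]; [ring|rewrite IH; ring].
  - apply block_sum_ge; lia.
Qed.

Lemma shift2_sum b s N k : (k <= N)%nat ->
  sum_f_R0 (fun m => block_coef b s m * shift (shift (block_row s m)) k) N
  = shift (shift (block_sum b s)) k.
Proof.
  destruct k as [|k]; intros H; cbn [shift].
  - clear H; induction N as [|N IH]; cbn [sum_f_R0]; [ring|rewrite IH; ring].
  - apply shift_sum; lia.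
Qed.

(** The recurrence cancels the rows below N; what remains of E on the partial sum is supported on
    the boundary rows N and N + 1. *)
Lemma frob_telescope b s k N : admissible b s ->
  sum_f_R0 (fun m => block_coef b s m * frob b s (block_row s m) k) N =
  - coefA b (s + 2 * INR (S N)) * block_coef b s (S N) * shift (shift (block_row s N)) k
  + coefC b (s + 2 * INR N) * block_coef b s N * shift (shift (block_row s (S N))) k.
Proof.
  intros Has. destruct (admissible_bounds _ _ Has) as [Hb Hs].
  assert (HA : forall n, coefA b (s + 2 * INR (S n)) <> 0).
  { intros n; apply Rgt_not_eq, coefA_pos; [lra|]. rewrite S_INR; pose proof (pos_INR n); lra. }
  induction N as [|N IH].
  - cbn [sum_f_R0]. rewrite frob_row_0 by assumption.
    specialize (HA 0%nat).
    rewrite block_coef_0, block_coef_1. simpl (INR 1) in *; simpl (INR 0).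
    replace (s + 2 * 1) with (s + 2) in * by ring. replace (s + 2 * 0) with s by ring.
    field. assumption.
  - cbn [sum_f_R0]. rewrite IH, frob_row_S by lra.
    specialize (HA (S N)).
    rewrite (block_coef_SS b s N). cbv zeta.
    replace (s + 2 * INR (S N) - 2) with (s + 2 * INR N) by (rewrite S_INR; ring).
    replace (s + 2 * INR (S (S N))) with (s + 2 * INR (S N) + 2) in * by (rewrite !S_INR; ring).
    field. assumption.
Qed.

Lemma frob_block_sum b s k : admissible b s -> frob b s (block_sum b s) k = 0.
Proof.
  intros Has.
  transitivity (sum_f_R0 (fun m => block_coef b s m * frob b s (block_row s m) k) k).
  - unfold frob at 1.
    rewrite <- (block_sum_ge b s k k), <- (shift_sum b s k k), <- (shift2_sum b s k k) by lia.
    rewrite 3!scal_sum, <- minus_sum, <- plus_sum. apply sum_eq; intros i _.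
    unfold frob; ring.
  (* With N = k, both boundary rows start beyond z^k. *)
  - rewrite frob_telescope by assumption. unfold block_row. rewrite !nshift_shift2.
    rewrite !nshift_lt by lia. ring.
Qed.

(** The factor of u_(k+1) is the indicial polynomial at s + k + 1, equal to (s + k + 1)(s + k + 2b)
    > 0, so each coefficient is determined by the earlier ones. *)
Lemma frob_unique b s u v : admissible b s ->
  (forall k, frob b s u k = 0) -> (forall k, frob b s v k = 0) -> u 0%nat = v 0%nat ->
  forall k, u k = v k.
Proof.
  intros Has Hu Hv H0 k. destruct (admissible_bounds _ _ Has) as [Hb Hs].
  induction k as [k IH] using (well_founded_induction lt_wf).
  destruct k as [|k]; [assumption|].
  specialize (Hu (S k)); specialize (Hv (S k)).
  unfold frob in Hu, Hv. cbn [shift] in Hu, Hv.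
  rewrite (IH k) in Hu by lia.
  assert (E : shift u k = shift v k) by (destruct k; [reflexivity|apply IH; lia]).
  rewrite E in Hu.
  assert (Hc : 0 < (s + INR (S k)) * (s + INR (S k) - 1 + 2 * b)).
  { rewrite S_INR; pose proof (pos_INR k). apply Rmult_lt_0_compat; lra. }
  apply Rmult_eq_reg_l with ((s + INR (S k)) * (s + INR (S k) - 1 + 2 * b)); lra.
Qed.

Lemma block_sum_0 b s : block_sum b s 0 = 1.
Proof.
  unfold block_sum, block_row. simpl. rewrite block_coef_0.
  cbn [nshift]. rewrite kc_0. ring.
Qed.

(** * The differential equation of the Virasoro blocks *)

Lemma hyp_coef_S a b c k : 0 < c ->
  hyp_coef a b c (S k) = hyp_coef a b c k * ((a + INR k) * (b + INR k) / ((c + INR k) * (INR k + 1))).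
Proof.
  intros Hc. unfold hyp_coef. cbn [pochhammer]. rewrite fact_simpl, mult_INR, S_INR.
  pose proof (pos_INR k). pose proof (INR_fact_neq_0 k).
  pose proof (Rgt_not_eq _ _ (pochhammer_pos c k Hc)).
  field. repeat split; lra.
Qed.

Lemma hyp_coef_neq_0 a b c k : (forall j, a + INR j <> 0) -> (forall j, b + INR j <> 0) -> 0 < c ->
  hyp_coef a b c k <> 0.
Proof.
  intros Ha Hb Hc. induction k as [|k IH].
  - unfold hyp_coef; simpl. lra.
  - rewrite hyp_coef_S by assumption. specialize (Ha k); specialize (Hb k).
    pose proof (pos_INR k).
    apply Rmult_integral_contrapositive_currified; [assumption|].
    apply Rmult_integral_contrapositive_currified.
    + apply Rmult_integral_contrapositive_currified; assumption.
    + apply Rinv_neq_0_compat, Rmult_integral_contrapositive_currified; lra.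
Qed.

Lemma is_lim_seq_ratio a c : is_lim_seq (fun n => (a + INR n) / (c + INR n)) 1.
Proof.
  apply (is_lim_seq_ext_loc (fun n => 1 + (a - c) * / (c + INR n))).
  - destruct (nfloor_ex (Rabs c) (Rabs_pos c)) as [N HN].
    exists (S N); intros n Hn. apply le_INR in Hn. rewrite S_INR in Hn.
    assert (- c <= Rabs c) by (rewrite <- Rabs_Ropp; apply RRle_abs).
    field. lra.
  - replace (Finite 1) with (Rbar_plus 1 (Rbar_mult (a - c) 0)) by (simpl; f_equal; ring).
    apply is_lim_seq_plus'; [apply is_lim_seq_const|].
    apply (is_lim_seq_scal_l _ _ 0).
    apply (is_lim_seq_inv _ p_infty); [|discriminate].
    apply is_lim_seq_plus with c p_infty; [apply is_lim_seq_const|apply is_lim_seq_INR|reflexivity].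
Qed.

Lemma CV_radius_hyp a b c : (forall j, a + INR j <> 0) -> (forall j, b + INR j <> 0) -> 0 < c ->
  CV_radius (hyp_coef a b c) = 1.
Proof.
  intros Ha Hb Hc.
  rewrite (CV_radius_finite_DAlembert _ 1); [f_equal; field| |lra|].
  - intros n; apply hyp_coef_neq_0; assumption.
  - replace (Finite 1) with (Rbar_abs 1) by (simpl; rewrite Rabs_R1; reflexivity).
    apply is_lim_seq_abs.
    apply is_lim_seq_ext with (fun n => (a + INR n) / (c + INR n) * ((b + INR n) / (1 + INR n))).
    + intros n. rewrite hyp_coef_S by assumption. pose proof (pos_INR n).
      pose proof (hyp_coef_neq_0 a b c n Ha Hb Hc). field. repeat split; lra.
    + replace (Finite 1) with (Finite (1 * 1)) by (f_equal; ring).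
      apply is_lim_seq_mult'; apply is_lim_seq_ratio.
Qed.

Lemma CV_radius_pos_of_ex u x : x <> 0 -> ex_pseries u x -> Rbar_lt 0 (CV_radius u).
Proof.
  intros Hx Hu. destruct (Rbar_lt_le_dec 0 (CV_radius u)) as [H|H]; [assumption|exfalso].
  apply (CV_disk_outside u x).
  - apply Rbar_le_lt_trans with (Finite 0); [assumption|]. simpl. apply Rabs_pos_lt; assumption.
  - apply ex_series_lim_0, ex_pseries_R, Hu.
Qed.

Lemma is_pseries_ext_R (u v : nat -> R) (x l : R) :
  (forall k, u k = v k) -> is_pseries u x l -> is_pseries v x l.
Proof. exact (is_pseries_ext u v x l). Qed.

(** The Euler operator theta = z d/dz on coefficient sequences. *)
Definition euler (u : nat -> R) (k : nat) : R := INR k * u k.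

Lemma CV_radius_shift u : CV_radius (shift u) = CV_radius u.
Proof. rewrite <- (CV_radius_incr_1 u). apply CV_radius_ext. intros [|n]; reflexivity. Qed.

Lemma is_pseries_shift u x l : is_pseries u x l -> is_pseries (shift u) x (x * l).
Proof.
  intros H. apply is_pseries_incr_1 in H.
  eapply is_pseries_ext_R; [|exact H]. intros [|n]; reflexivity.
Qed.

Lemma CV_radius_euler u : CV_radius (euler u) = CV_radius u.
Proof.
  transitivity (CV_radius (shift (PS_derive u))).
  - apply CV_radius_ext. intros [|n]; unfold euler, PS_derive; simpl; ring.
  - rewrite CV_radius_shift. apply CV_radius_derive.
Qed.

(** The operator x theta^2 + y theta + z. *)
Definition quad (x y z : R) (u : nat -> R) (k : nat) : R :=
  (x * (INR k * INR k) + y * INR k + z) * u k.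

Lemma is_pseries_quad x y z u t l0 l1 l2 :
  is_pseries u t l0 -> is_pseries (euler u) t l1 -> is_pseries (euler (euler u)) t l2 ->
  is_pseries (quad x y z u) t (x * l2 + y * l1 + z * l0).
Proof.
  intros H0 H1 H2. apply is_pseries_R in H0, H1, H2. apply is_pseries_R.
  apply (is_series_scal x) in H2. apply (is_series_scal y) in H1. apply (is_series_scal z) in H0.
  eapply is_series_ext; [|exact (is_series_plus _ _ _ _ (is_series_plus _ _ _ _ H2 H1) H0)].
  intros n. unfold plus, scal; simpl. unfold mult, euler, quad; simpl. ring.
Qed.

Lemma euler_PS_mult u v k :
  euler (PS_mult u v) k = PS_mult (euler u) v k + PS_mult u (euler v) k.
Proof.
  unfold euler at 1, PS_mult. rewrite <- plus_sum, scal_sum.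
  apply sum_eq; intros i Hi. unfold euler. rewrite minus_INR by assumption. ring.
Qed.

(** Decomposition Q_0 - z Q_1 + z^2 Q_2 with each Q_i quadratic in theta; the indicial equation
    removes the constant term of Q_0. *)
Lemma frob_quad b s u k : s * (s - 1 + 2 * b) = 0 ->
  frob b s u k =
  quad 1 (2 * s - 1 + 2 * b) 0 u k
  - shift (quad 2 (4 * s - 1 + 3 * b) (s * (2 * s - 1 + 3 * b)) u) k
  + shift (shift (quad 1 (2 * s + b) (s * s + b * s - (1 - 3 * b) * (1 - b) / 4) u)) k.
Proof.
  intros Hs.
  assert (E : s * s = s * (1 - 2 * b)) by lra.
  destruct k as [|[|k]]; unfold frob, quad; cbn [shift]; rewrite ?S_INR; simpl (INR 0).
  - replace ((s + 0) * (s + 0 - 1 + 2 * b)) with 0 by lra. ring.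
  - replace ((s + (0 + 1)) * (s + (0 + 1) - 1 + 2 * b)) with
      (s * (s - 1 + 2 * b) + (2 * s + 2 * b)) by ring. rewrite Hs. ring.
  - replace ((s + (INR k + 1 + 1)) * (s + (INR k + 1 + 1) - 1 + 2 * b)) with
      (s * (s - 1 + 2 * b) + (INR k + 2) * (2 * s - 1 + 2 * b + (INR k + 2))) by ring.
    rewrite Hs. field.
Qed.

(* (1 - z)^(-d) is the degenerate case 2F1(d, 1; 1; z). *)
Definition virasoro_coef (d s : R) : nat -> R :=
  PS_mult (hyp_coef d 1 1)
    (hyp_coef (s - 2 * d) (s + (1 - 2 * d) / 3) (2 * s + 2 * ((1 - 2 * d) / 3))).

Definition hyp_regular (d s : R) : Prop :=
  / 8 < d < / 2 /\ (s = 0 \/ s = (1 + 4 * d) / 3).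

(** With b = (1 - 2d)/3, the parameters s - 2d, s + b, 2s + 2b specialize at s = 0 and s = h = 1 -
    2b to those of the two Virasoro blocks, so both are treated at once. Neither series terminates,
    as the ratio test in [CV_radius_hyp] requires. *)
Lemma hyp_regular_params d s : hyp_regular d s ->
  admissible ((1 - 2 * d) / 3) s /\
  (forall j, s - 2 * d + INR j <> 0) /\ (forall j, s + (1 - 2 * d) / 3 + INR j <> 0)
  /\ 0 < 2 * s + 2 * ((1 - 2 * d) / 3).
Proof.
  intros [Hd Hs]. split; [|split; [|split]].
  - split; [lra|]. destruct Hs; [left|right]; lra.
  - intros [|j]; [simpl; destruct Hs; lra|].
    rewrite S_INR; pose proof (pos_INR j); destruct Hs; lra.
  - intros j; pose proof (pos_INR j); destruct Hs; lra.
  - destruct Hs; lra.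
Qed.

(** Works with values at t: the first-order equation of (1 - z)^(-d) and the hypergeometric equation
    express all theta-derivatives of the product, by the Leibniz rule, through [W0], [F0], [F1], and
    the claim becomes a rational identity. *)
Lemma frob_virasoro d s t : hyp_regular d s -> Rabs t < 1 ->
  is_pseries (frob ((1 - 2 * d) / 3) s (virasoro_coef d s)) t 0.
Proof.
  intros Hds Ht. destruct (hyp_regular_params d s Hds) as [Has [HA [HB HC]]].
  destruct Hds as [Hd Hs].
  set (b := (1 - 2 * d) / 3) in *.
  unfold virasoro_coef. fold b.
  set (A := s - 2 * d) in *. set (B := s + b) in *. set (C := 2 * s + 2 * b) in *.
  set (w := hyp_coef d 1 1). set (f := hyp_coef A B C). set (g := PS_mult w f).
  assert (Rw : CV_radius w = 1).
  { apply CV_radius_hyp; [| |lra]; intros j; pose proof (pos_INR j); lra. }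
  assert (Rf : CV_radius f = 1) by (apply CV_radius_hyp; assumption).
  assert (Ct : forall u, CV_radius u = 1 -> Rbar_lt (Rabs t) (CV_radius u)) by (intros u ->; exact Ht).
  assert (Ew : forall u, CV_radius u = 1 -> CV_radius (euler u) = 1)
    by (intros; rewrite CV_radius_euler; assumption).
  set (W0 := PSeries w t). set (W1 := PSeries (euler w) t). set (W2 := PSeries (euler (euler w)) t).
  set (F0 := PSeries f t). set (F1 := PSeries (euler f) t). set (F2 := PSeries (euler (euler f)) t).
  assert (PM : forall u v, CV_radius u = 1 -> CV_radius v = 1 ->
    is_pseries (PS_mult u v) t (PSeries u t * PSeries v t)).
  { intros u v Hu Hv. apply is_pseries_mult; auto;
    apply PSeries_correct, CV_disk_correct, CV_disk_inside; auto. }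
  assert (G1s : is_pseries (euler g) t (W1 * F0 + W0 * F1)).
  { eapply is_pseries_ext_R; [|exact (is_pseries_plus _ _ _ _ _
      (PM (euler w) f (Ew _ Rw) Rf) (PM w (euler f) Rw (Ew _ Rf)))].
    intros k; unfold g; rewrite euler_PS_mult; reflexivity. }
  assert (G2s : is_pseries (euler (euler g)) t (W2 * F0 + 2 * (W1 * F1) + W0 * F2)).
  { replace (W2 * F0 + 2 * (W1 * F1) + W0 * F2) with
      ((W2 * F0 + W1 * F1) + (W1 * F1 + W0 * F2)) by ring.
    eapply is_pseries_ext_R; [|exact
      (is_pseries_plus _ _ _ _ _
        (is_pseries_plus _ _ _ _ _ (PM (euler (euler w)) f (Ew _ (Ew _ Rw)) Rf)
          (PM (euler w) (euler f) (Ew _ Rw) (Ew _ Rf)))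
        (is_pseries_plus _ _ _ _ _ (PM (euler w) (euler f) (Ew _ Rw) (Ew _ Rf))
          (PM w (euler (euler f)) Rw (Ew _ (Ew _ Rf)))))].
    intros k. unfold PS_plus, plus; simpl.
    change (euler (euler g) k) with (INR k * euler g k).
    unfold g; rewrite euler_PS_mult, Rmult_plus_distr_l.
    f_equal; symmetry; apply euler_PS_mult. }
  assert (V : forall u, CV_radius u = 1 -> is_pseries u t (PSeries u t)).
  { intros u Hu. apply PSeries_correct, CV_disk_correct, CV_disk_inside; auto. }
  assert (Q : forall x y z u, CV_radius u = 1 -> is_pseries (quad x y z u) t
    (x * PSeries (euler (euler u)) t + y * PSeries (euler u) t + z * PSeries u t)).
  { intros; apply is_pseries_quad; auto. }
  (* theta w = z (theta + d) w for w = (1 - z)^(-d). *)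
  assert (RW1 : W1 = t * (W1 + d * W0)).
  { apply is_pseries_unique.
    replace (W1 + d * W0) with (0 * W2 + 1 * W1 + d * W0) by ring.
    eapply is_pseries_ext_R; [|exact (is_pseries_shift _ _ _ (Q 0 1 d w Rw))].
    intros [|k]; unfold euler, quad, shift, w; [simpl; ring|].
    rewrite hyp_coef_S, S_INR by lra. pose proof (pos_INR k). field. lra. }
  (* The previous equation after one more theta: theta^2 w = z (theta + 1)(theta + d) w. *)
  assert (RW2 : W2 = t * (W2 + (d + 1) * W1 + d * W0)).
  { apply is_pseries_unique.
    replace (W2 + (d + 1) * W1 + d * W0) with (1 * W2 + (d + 1) * W1 + d * W0) by ring.
    eapply is_pseries_ext_R; [|exact (is_pseries_shift _ _ _ (Q 1 (d + 1) d w Rw))].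
    intros [|k]; unfold euler, quad, shift, w; [simpl; ring|].
    rewrite hyp_coef_S, S_INR by lra. pose proof (pos_INR k). field. lra. }
  (* Gauss's equation theta (theta + C - 1) f = z (theta + A)(theta + B) f. *)
  assert (RF : F2 + (C - 1) * F1 = t * (F2 + (A + B) * F1 + A * B * F0)).
  { transitivity (1 * F2 + (C - 1) * F1 + 0 * F0); [ring|].
    transitivity (PSeries (quad 1 (C - 1) 0 f) t);
      [symmetry; exact (is_pseries_unique _ _ _ (Q 1 (C - 1) 0 f Rf))|].
    apply is_pseries_unique.
    replace (F2 + (A + B) * F1 + A * B * F0) with (1 * F2 + (A + B) * F1 + A * B * F0) by ring.
    eapply is_pseries_ext_R; [|exact (is_pseries_shift _ _ _ (Q 1 (A + B) (A * B) f Rf))].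
    intros [|k]; unfold quad, shift, f; [simpl; ring|].
    rewrite hyp_coef_S, S_INR by assumption. pose proof (pos_INR k). field. lra. }
  assert (G0s : is_pseries g t (W0 * F0)) by (apply PM; assumption).
  assert (Hs0 : s * (s - 1 + 2 * b) = 0) by (unfold b; destruct Hs as [-> | ->]; field).
  set (Y1 := W1 * F0 + W0 * F1) in *. set (Y2 := W2 * F0 + 2 * (W1 * F1) + W0 * F2) in *.
  set (Y0 := W0 * F0) in *.
  pose proof (fun x y z => is_pseries_quad x y z g t _ _ _ G0s G1s G2s) as GQ.
  evar_last.
  { eapply is_pseries_ext_R; [intros k; exact (eq_sym (frob_quad b s g k Hs0))|].
    exact (is_pseries_plus _ _ _ _ _
        (is_pseries_minus _ _ _ _ _ (GQ _ _ _) (is_pseries_shift _ _ _ (GQ _ _ _)))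
        (is_pseries_shift _ _ _ (is_pseries_shift _ _ _ (GQ _ _ _)))). }
  unfold plus, opp; simpl.
  assert (Ht1 : 1 - t <> 0) by (apply Rabs_def2 in Ht; lra).
  assert (S1 : W1 = t * d * W0 / (1 - t)).
  { apply Rmult_eq_reg_l with (1 - t); [|assumption]. field_simplify; [|assumption]. lra. }
  assert (S2 : W2 = t * ((d + 1) * W1 + d * W0) / (1 - t)).
  { apply Rmult_eq_reg_l with (1 - t); [|assumption]. field_simplify; [|assumption]. lra. }
  assert (S3 : F2 = (t * ((A + B) * F1 + A * B * F0) - (C - 1) * F1) / (1 - t)).
  { apply Rmult_eq_reg_l with (1 - t); [|assumption]. field_simplify; [|assumption]. lra. }
  unfold Y2, Y1, Y0. rewrite S3, S2, S1. clearbody W0 F0 F1.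
  unfold A, B, C, b. destruct Hs as [-> | ->]; field; assumption.
Qed.

(** Both sequences solve the Frobenius recurrence with constant term 1. For the Virasoro side the
    recurrence is read off from a power series that vanishes near 0. *)
Lemma virasoro_coef_block_sum d s k : hyp_regular d s ->
  virasoro_coef d s k = block_sum ((1 - 2 * d) / 3) s k.
Proof.
  intros Hds. destruct (hyp_regular_params d s Hds) as [Has _].
  revert k. apply (frob_unique _ _ _ _ Has).
  - intros k.
    apply (PSeries_ext_recip _ (fun _ => 0)).
    + apply CV_radius_pos_of_ex with (/ 2); [lra|]. exists 0. apply frob_virasoro; [assumption|].
      rewrite Rabs_pos_eq; lra.
    + rewrite CV_radius_const_0; exact I.
    + exists (mkposreal 1 Rlt_0_1). intros x Hx.
      rewrite PSeries_const_0. apply is_pseries_unique, frob_virasoro; [assumption|].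
      rewrite <- (Rminus_0_r x). exact Hx.
  - intros k; apply frob_block_sum; assumption.
  - rewrite block_sum_0. unfold virasoro_coef, PS_mult, hyp_coef. simpl. field.
Qed.

(** Since (1 - t) w' = d w, the function (1 - t)^d w(t) has zero derivative and keeps its value 1
    from t = 0. *)
Lemma binomial_series d z : 0 < d -> 0 < z < 1 ->
  PSeries (hyp_coef d 1 1) z = Rpower (1 - z) (- d).
Proof.
  intros Hd Hz. set (w := hyp_coef d 1 1).
  assert (Rw : CV_radius w = 1).
  { apply CV_radius_hyp; [| |lra]; intros j; pose proof (pos_INR j); lra. }
  assert (E : Rpower (1 - 0) d * PSeries w 0 = Rpower (1 - z) d * PSeries w z).
  { apply (eq_is_derive (fun t => Rpower (1 - t) d * PSeries w t)); [|lra].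
    intros t Ht.
    assert (Ct : Rbar_lt (Rabs t) (CV_radius w)) by (rewrite Rw, Rabs_pos_eq; simpl; lra).
    assert (V : forall u, CV_radius u = 1 -> is_pseries u t (PSeries u t)).
    { intros u Hu. apply PSeries_correct, CV_disk_correct, CV_disk_inside.
      rewrite Hu, <- Rw; assumption. }
    assert (D : PSeries (PS_derive w) t * (1 - t) = d * PSeries w t).
    { assert (D1 : PSeries (PS_derive w) t = 0 * PSeries (euler (euler w)) t
        + 1 * PSeries (euler w) t + d * PSeries w t).
      { apply is_pseries_unique. eapply is_pseries_ext_R;
          [|apply (is_pseries_quad 0 1 d w); apply V; rewrite ?CV_radius_euler; assumption].
        intros k. unfold PS_derive, quad, w. rewrite hyp_coef_S, S_INR by lra.
        pose proof (pos_INR k). field. lra. }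
      assert (D2 : PSeries (euler w) t = t * PSeries (PS_derive w) t).
      { apply is_pseries_unique. eapply is_pseries_ext_R; [|apply is_pseries_shift, V; rewrite CV_radius_derive; exact Rw].
        intros [|k]; unfold euler, shift, PS_derive; simpl; ring. }
      rewrite D2 in D1. lra. }
    assert (D0 : is_derive (fun t => Rpower (1 - t) d) t (- d / (1 - t) * Rpower (1 - t) d)).
    { apply (is_derive_ext (fun t => exp (d * ln (1 - t)))); [intros; reflexivity|].
      auto_derive; [lra|unfold Rpower, Rminus; field; lra]. }
    evar_last.
    { apply (is_derive_mult (fun t => Rpower (1 - t) d) (PSeries w));
        [exact D0|apply is_derive_PSeries; assumption|intros; apply Rmult_comm]. }
    unfold plus, mult, zero; simpl.
    transitivity (Rpower (1 - t) d / (1 - t) * (PSeries (PS_derive w) t * (1 - t) - d * PSeries w t)).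
    - field. lra.
    - rewrite D; ring. }
  replace (1 - 0) with 1 in E by ring.
  rewrite PSeries_0 in E. unfold Rpower at 1 in E. rewrite ln_1, Rmult_0_r, exp_0 in E.
  assert (w 0%nat = 1) by (unfold w, hyp_coef; simpl; field).
  rewrite Rpower_Ropp. pose proof (exp_pos (d * ln (1 - z))) as Hp. fold (Rpower (1 - z) d) in Hp.
  apply Rmult_eq_reg_l with (Rpower (1 - z) d); [|lra]. rewrite <- E. rewrite H. field. lra.
Qed.

Lemma virasoro_block_series d s z : hyp_regular d s -> 0 < z < 1 ->
  is_pseries (virasoro_coef d s) z
    (Rpower (1 - z) (- d) * hyp2F1 (s - 2 * d) (s + (1 - 2 * d) / 3) (2 * s + 2 * ((1 - 2 * d) / 3)) z).
Proof.
  intros Hds Hz. destruct (hyp_regular_params d s Hds) as [_ [HA [HB HC]]].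
  destruct Hds as [Hd _].
  rewrite <- binomial_series by lra.
  assert (Rw : CV_radius (hyp_coef d 1 1) = 1).
  { apply CV_radius_hyp; [| |lra]; intros j; pose proof (pos_INR j); lra. }
  apply is_pseries_mult.
  1,2: apply PSeries_correct, CV_disk_correct, CV_disk_inside.
  all: rewrite ?Rw, ?CV_radius_hyp by assumption; rewrite Rabs_pos_eq; simpl; lra.
Qed.

(** * Rearrangement into global blocks *)

Lemma partial_sum_le_series a l N : (forall n, 0 <= a n) -> is_series a l -> sum_f_R0 a N <= l.
Proof.
  intros Ha Hl. apply is_series_Reals in Hl. apply sum_incr; assumption.
Qed.

Lemma is_series_sum_f_R0 (d : nat -> nat -> R) (D : nat -> R) N :
  (forall m, is_series (d m) (D m)) ->
  is_series (fun k => sum_f_R0 (fun m => d m k) N) (sum_f_R0 D N).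
Proof.
  intros H; induction N as [|N IH]; [apply H|].
  exact (is_series_plus _ _ _ _ IH (H (S N))).
Qed.

Lemma is_series_le a b la lb : (forall n, a n <= b n) -> is_series a la -> is_series b lb -> la <= lb.
Proof.
  intros Hab Ha Hb.
  change (Rbar_le la lb).
  apply (is_lim_seq_le (sum_n a) (sum_n b)); [|exact Ha|exact Hb].
  intros n. rewrite !sum_n_Reals. apply sum_Rle; intros; apply Hab.
Qed.

(** Squeeze: columns k <= N meet only rows m <= N, so the sum of the first columns is at most that
    of the first row totals [D], which in turn is at most the total [G] of all columns. *)
Lemma triangular_tonelli (d : nat -> nat -> R) (D : nat -> R) (G : R) :
  (forall m k, 0 <= d m k) -> (forall m k, (k < m)%nat -> d m k = 0) ->
  (forall m, is_series (d m) (D m)) ->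
  is_series (fun k => sum_f_R0 (fun m => d m k) k) G -> is_series D G.
Proof.
  intros Hpos Htri HD HG.
  assert (Hcol : forall N k, (k <= N)%nat ->
    sum_f_R0 (fun m => d m k) N = sum_f_R0 (fun m => d m k) k).
  { intros N k H; induction H as [|N H IH]; [reflexivity|].
    cbn [sum_f_R0]. rewrite IH, Htri by lia. ring. }
  change (is_lim_seq (sum_n D) G).
  apply (is_lim_seq_le_le (sum_n (fun k => sum_f_R0 (fun m => d m k) k)) _ (fun _ => G)).
  - intros N. rewrite !sum_n_Reals. split.
    + apply Rle_trans with (sum_f_R0 (fun k => sum_f_R0 (fun m => d m k) N) N).
      * right. apply sum_eq; intros k Hk. symmetry; apply Hcol; assumption.
      * apply partial_sum_le_series; [|apply is_series_sum_f_R0; assumption].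
        intros k; apply cond_pos_sum; intros; apply Hpos.
    + refine (is_series_le _ _ _ _ _ (is_series_sum_f_R0 d D N HD) HG).
      intros k. destruct (Nat.le_gt_cases k N) as [H|H]; [rewrite (Hcol N k H); lra|].
      rewrite (tech2 (fun m => d m k) N k) by assumption.
      assert (0 <= sum_f_R0 (fun i => d (S N + i)%nat k) (k - S N))
        by (apply cond_pos_sum; intros; apply Hpos). lra.
  - exact HG.
  - apply is_lim_seq_const.
Qed.

Lemma global_block_series p z : 0 <= p -> 0 < z < 1 ->
  exists l, is_pseries (kc p) z l /\ global_block p z = Rpower z p * l.
Proof.
  intros Hp Hz. unfold global_block. destruct (Req_EM_T p 0) as [->|Hp0].
  - exists 1. split; [|rewrite Rpower_O; lra].
    apply is_pseries_R. apply is_series_Reals. intros e He. exists 0%nat. intros n _.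
    replace (sum_f_R0 (fun k => kc 0 k * z ^ k) n) with 1.
    { unfold Rdist. rewrite Rminus_diag, Rabs_R0; assumption. }
    induction n as [|n IH]; [simpl; rewrite kc_0; ring|].
    cbn [sum_f_R0]. rewrite <- IH, kc_zero_l. ring.
  - exists (hyp2F1 p p (2 * p) z). split; [|reflexivity].
    apply PSeries_correct, CV_disk_correct, CV_disk_inside.
    change (fun k => _) with (hyp_coef p p (2 * p)).
    unfold kc; rewrite CV_radius_hyp; [rewrite Rabs_pos_eq; simpl; lra| | |lra];
    intros j; pose proof (pos_INR j); lra.
Qed.

Lemma is_pseries_nshift n u x l : is_pseries u x l -> is_pseries (nshift n u) x (x ^ n * l).
Proof.
  intros H; induction n as [|n IH]; [simpl; rewrite Rmult_1_l; exact H|].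
  simpl. rewrite Rmult_assoc. apply is_pseries_shift. exact IH.
Qed.

Lemma virasoro_block_expansion d s z : hyp_regular d s -> 0 < z < 1 ->
  is_series (fun m => block_coef ((1 - 2 * d) / 3) s m * global_block (s + 2 * INR m) z)
    (Rpower z s * (Rpower (1 - z) (- d)
      * hyp2F1 (s - 2 * d) (s + (1 - 2 * d) / 3) (2 * s + 2 * ((1 - 2 * d) / 3)) z)).
Proof.
  intros Hds Hz. destruct (hyp_regular_params d s Hds) as [Has _].
  destruct (admissible_bounds _ _ Has) as [_ Hs].
  pose proof (virasoro_block_series d s z Hds Hz) as HG. apply is_pseries_R in HG.
  set (b := (1 - 2 * d) / 3) in *.
  apply (triangular_tonelli (fun m k => Rpower z s * (block_coef b s m * block_row s m k * z ^ k))).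
  - intros m k. apply Rmult_le_pos; [apply Rlt_le, exp_pos|].
    apply Rmult_le_pos; [|apply pow_le; lra].
    apply Rmult_le_pos; [apply Rlt_le, block_coef_pos; assumption|apply block_row_nonneg; lra].
  - intros m k Hk. rewrite block_row_lt by lia. ring.
  - intros m. pose proof (pos_INR m).
    destruct (global_block_series (s + 2 * INR m) z) as [l [Hl ->]]; [lra|assumption|].
    apply (is_pseries_nshift (2 * m)) in Hl. apply is_pseries_R in Hl.
    apply (is_series_scal (Rpower z s * block_coef b s m)) in Hl.
    evar_last; [eapply is_series_ext; [|exact Hl]|].
    + intros k. unfold scal; simpl; unfold mult; simpl. unfold block_row. simpl. ring.
    + unfold scal; simpl; unfold mult; simpl.
      rewrite Rpower_plus. replace (2 * INR m) with (INR (2 * m)) by (rewrite mult_INR; reflexivity).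
      rewrite Rpower_pow by lra. simpl. ring.
  - apply (is_series_scal (Rpower z s)) in HG. eapply is_series_ext; [|exact HG].
    intros k. unfold scal; simpl; unfold mult; simpl.
    rewrite virasoro_coef_block_sum by assumption. fold b. unfold block_sum.
    rewrite Rmult_comm, Rmult_assoc, Rmult_comm, scal_sum. apply sum_eq; intros; ring.
Qed.

(** Only weights s + 2m occur, while [block_expansion] indexes all weights s + n; odd places receive
    0. *)
Definition sparse (u : nat -> R) (n : nat) : R := if Nat.even n then u (Nat.div2 n) else 0.

Lemma sum_sparse u N : sum_f_R0 (sparse u) N = sum_f_R0 u (Nat.div2 N).
Proof.
  assert (H : sum_f_R0 (sparse u) (2 * Nat.div2 N) = sum_f_R0 u (Nat.div2 N)
    /\ sum_f_R0 (sparse u) (S (2 * Nat.div2 N)) = sum_f_R0 u (Nat.div2 N)).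
  { induction (Nat.div2 N) as [|m [_ IH]].
    - unfold sparse; simpl; lra.
    - replace (2 * S m)%nat with (S (S (2 * m))) by lia.
      assert (E : sum_f_R0 (sparse u) (S (S (2 * m))) = sum_f_R0 u (S m)).
      { cbn [sum_f_R0]. cbn [sum_f_R0] in IH. rewrite IH. f_equal. unfold sparse.
        replace (S (S (2 * m))) with (2 * S m)%nat by lia.
        rewrite Nat.even_mul, Nat.div2_double. reflexivity. }
      split; [exact E|]. rewrite tech5, E. unfold sparse at 1.
      replace (S (S (S (2 * m)))) with (S (2 * S m))%nat by lia.
      rewrite Nat.even_succ, <- Nat.negb_even, Nat.even_mul. simpl. ring. }
  pose proof (Nat.div2_odd N) as EN.
  destruct (Nat.odd N); simpl in EN; rewrite EN at 1; [rewrite Nat.add_1_r|rewrite Nat.add_0_r]; apply H.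
Qed.

Lemma is_series_sparse u l : is_series u l -> is_series (sparse u) l.
Proof.
  intros H.
  assert (L : is_lim_seq (fun N => sum_n u (Nat.div2 N)) l).
  { apply (is_lim_seq_subseq (sum_n u)); [|exact H].
    intros P [N HN]. exists (2 * N)%nat. intros n Hn. apply HN.
    rewrite <- (Nat.div2_double N). apply Nat.div2_le_mono; assumption. }
  apply (is_lim_seq_ext _ (sum_n (sparse u))) in L; [exact L|].
  intros N. rewrite !sum_n_Reals. symmetry; apply sum_sparse.
Qed.

(** * Uniqueness of block expansions *)

Lemma global_block_ge p z : 0 <= p -> 0 < z < 1 -> Rpower z p <= global_block p z.
Proof.
  intros Hp Hz. destruct (global_block_series p z Hp Hz) as [l [Hl ->]].
  apply is_pseries_R in Hl.
  assert (0 < Rpower z p) by apply exp_pos.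
  assert (1 <= l).
  { apply Rle_trans with (sum_f_R0 (fun k => kc p k * z ^ k) 0).
    - simpl. rewrite kc_0. lra.
    - apply partial_sum_le_series; [|assumption].
      intros n; apply Rmult_le_pos; [apply kc_nonneg; assumption|apply pow_le; lra]. }
  nra.
Qed.

Lemma global_block_pos p z : 0 <= p -> 0 < z < 1 -> 0 < global_block p z.
Proof.
  intros Hp Hz. apply Rlt_le_trans with (Rpower z p); [apply exp_pos|].
  apply global_block_ge; assumption.
Qed.

Lemma Rpower_le_exponent w p q : 0 < w < 1 -> q <= p -> Rpower w p <= Rpower w q.
Proof.
  intros Hw Hpq. replace p with (q + (p - q)) by ring. rewrite Rpower_plus.
  assert (0 < Rpower w q) by apply exp_pos.
  assert (Rpower w (p - q) <= 1).
  { unfold Rpower. rewrite <- exp_0.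
    assert (ln w < 0) by (rewrite <- ln_1; apply ln_increasing; lra).
    assert ((p - q) * ln w <= 0) by nra.
    destruct (Rle_lt_or_eq_dec _ _ H1) as [H2|H2]; [apply Rlt_le, exp_increasing; assumption|rewrite H2; lra]. }
  nra.
Qed.

(** The power series factor of K_p is non-decreasing and w^p <= w^q. A common q <= p gives one rate
    for a whole tail of blocks. *)
Lemma global_block_decay p q z0 w : 0 <= p -> q <= p -> 0 < z0 < 1 -> 0 < w < 1 ->
  global_block p (z0 * w) <= Rpower w q * global_block p z0.
Proof.
  intros Hp Hq Hz Hw.
  assert (Hzw : 0 < z0 * w < 1) by nra.
  destruct (global_block_series p z0 Hp Hz) as [l0 [Hl0 ->]].
  destruct (global_block_series p (z0 * w) Hp Hzw) as [l [Hl ->]].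
  apply is_pseries_R in Hl, Hl0.
  assert (Hll : l <= l0).
  { apply (is_series_le _ _ _ _) with (2 := Hl) (3 := Hl0). intros n.
    apply Rmult_le_compat_l; [apply kc_nonneg; assumption|apply pow_incr; nra]. }
  assert (H0 : 0 <= l).
  { apply Rle_trans with (sum_f_R0 (fun k => kc p k * (z0 * w) ^ k) 0).
    - simpl. rewrite kc_0. lra.
    - apply partial_sum_le_series; [|assumption].
      intros n; apply Rmult_le_pos; [apply kc_nonneg; assumption|apply pow_le; lra]. }
  rewrite <- Rpower_mult_distr by lra.
  assert (0 < Rpower z0 p) by apply exp_pos.
  assert (0 < Rpower w p) by apply exp_pos.
  pose proof (Rpower_le_exponent w p q Hw Hq).
  apply Rle_trans with (Rpower z0 p * Rpower w p * l0).
  - apply Rmult_le_compat_l; nra.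
  - replace (Rpower w q * (Rpower z0 p * l0)) with (Rpower z0 p * Rpower w q * l0) by ring.
    apply Rmult_le_compat_r; [lra|]. nra.
Qed.

Lemma ex_series_Rabs_le (a b : nat -> R) :
  (forall n, Rabs (a n) <= b n) -> ex_series b -> ex_series a.
Proof. exact (@ex_series_le R_AbsRing R_CompleteNormedModule a b). Qed.

Lemma tail_decay (e u : nat -> R) q z0 w : 0 < z0 < 1 -> 0 < w < 1 ->
  (forall n, 0 <= e n) -> (forall n, u n = 0 \/ q <= e n) ->
  ex_series (fun n => Rabs (u n * global_block (e n) z0)) ->
  Rabs (Series (fun n => u n * global_block (e n) (z0 * w)))
  <= Rpower w q * Series (fun n => Rabs (u n * global_block (e n) z0)).
Proof.
  intros Hz Hw He Hu Hex.
  assert (Hzw : 0 < z0 * w < 1) by nra.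
  assert (Hle : forall n, 0 <= Rabs (u n * global_block (e n) (z0 * w))
     <= Rpower w q * Rabs (u n * global_block (e n) z0)).
  { intros n; split; [apply Rabs_pos|].
    pose proof (global_block_pos (e n) _ (He n) Hz).
    pose proof (global_block_pos (e n) _ (He n) Hzw).
    rewrite !Rabs_mult, (Rabs_pos_eq (global_block (e n) _)), (Rabs_pos_eq (global_block (e n) z0)) by lra.
    destruct (Hu n) as [->|Hq]; [rewrite Rabs_R0; lra|].
    pose proof (global_block_decay (e n) q z0 w (He n) Hq Hz Hw).
    pose proof (Rabs_pos (u n)). nra. }
  rewrite <- Series_scal_l.
  assert (Hex' : ex_series (fun n => Rpower w q * Rabs (u n * global_block (e n) z0)))
    by exact (@ex_series_scal R_AbsRing R_NormedModule (Rpower w q) _ Hex).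
  apply Rle_trans with (Series (fun n => Rabs (u n * global_block (e n) (z0 * w)))).
  - apply Series_Rabs. apply (ex_series_Rabs_le _ _) with (2 := Hex'). intros n.
    rewrite Rabs_Rabsolu. apply Hle.
  - apply Series_le; assumption.
Qed.

Lemma Rpower_dominated a M e1 e2 : e1 < e2 -> 0 <= M ->
  (forall w, 0 < w < 1 -> a * Rpower w e1 <= M * Rpower w e2) -> a <= 0.
Proof.
  intros He HM H. destruct (Rle_lt_dec a 0) as [|Ha]; [assumption|exfalso].
  (* Chosen so that w^(e2-e1) <= a / (2 (M + 1)), hence M w^(e2-e1) < a; the minimum with 1/2 keeps
     w below 1. *)
  set (w := Rmin (/ 2) (exp (ln (a / (2 * (M + 1))) / (e2 - e1)))).
  assert (Hr : 0 < a / (2 * (M + 1))) by (apply Rdiv_lt_0_compat; lra).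
  assert (Hw : 0 < w < 1).
  { unfold w. split.
    - apply Rmin_glb_lt; [lra|apply exp_pos].
    - apply Rle_lt_trans with (/ 2); [apply Rmin_l|lra]. }
  specialize (H w Hw).
  replace e2 with (e1 + (e2 - e1)) in H by ring. rewrite Rpower_plus in H.
  assert (H1 : 0 < Rpower w e1) by apply exp_pos.
  assert (H2 : Rpower w (e2 - e1) <= a / (2 * (M + 1))).
  { unfold Rpower. rewrite <- (exp_ln (a / (2 * (M + 1)))) by assumption.
    assert (L : ln w <= ln (a / (2 * (M + 1))) / (e2 - e1)).
    { rewrite <- (ln_exp (ln (a / (2 * (M + 1))) / (e2 - e1))).
      apply ln_le; [lra|apply Rmin_r]. }
    assert (E : (e2 - e1) * ln w <= ln (a / (2 * (M + 1)))).
    { apply Rmult_le_compat_l with (r := e2 - e1) in L; [|lra].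
      replace ((e2 - e1) * (ln (a / (2 * (M + 1))) / (e2 - e1))) with (ln (a / (2 * (M + 1)))) in L
        by (field; lra). exact L. }
    destruct (Rle_lt_or_eq_dec _ _ E) as [E'|E']; [apply Rlt_le, exp_increasing; assumption|rewrite E'; lra]. }
  assert (H3 : a <= M * (a / (2 * (M + 1)))).
  { apply Rmult_le_reg_r with (Rpower w e1); [assumption|].
    apply Rle_trans with (1 := H).
    assert (0 < Rpower w (e2 - e1)) by apply exp_pos.
    assert (M * (Rpower w e1 * Rpower w (e2 - e1)) <= M * (Rpower w e1 * (a / (2 * (M + 1)))))
      by (apply Rmult_le_compat_l; [lra|]; apply Rmult_le_compat_l; lra).
    lra. }
  assert (H4 : M * (a / (2 * (M + 1))) < a).
  { replace (M * (a / (2 * (M + 1)))) with (a - a * (M + 2) / (2 * (M + 1))) by (field; lra).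
    assert (0 < a * (M + 2) / (2 * (M + 1))) by (apply Rdiv_lt_0_compat; nra). lra. }
  lra.
Qed.

(** The lowest surviving block has exponent c + N. Solving for it and putting z = z0 w, the rest is
    of smaller order as w tends to 0. The families are interchangeable, so the lemma serves for
    either one. *)
Lemma leading_coef_zero (c c' : R) (N N' : nat) (u v : nat -> R) :
  0 <= c -> 0 <= c' -> c + INR N < c' + INR N' ->
  (forall n, (n < N)%nat -> u n = 0) -> (forall n, (n < N')%nat -> v n = 0) ->
  (forall z, 0 < z < 1 ->
    ex_series (fun n => Rabs (u n * global_block (c + INR n) z))
    /\ ex_series (fun n => Rabs (v n * global_block (c' + INR n) z))
    /\ Series (fun n => u n * global_block (c + INR n) z)
       + Series (fun n => v n * global_block (c' + INR n) z) = 0) ->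
  u N = 0.
Proof.
  intros Hc Hc' Hlt Hu Hv H.
  (* A lower bound for all other exponents that can still occur. *)
  set (e2 := Rmin (c + INR (S N)) (c' + INR N')).
  assert (He2 : c + INR N < e2) by (unfold e2; apply Rmin_glb_lt; [rewrite S_INR; lra|assumption]).
  set (z0 := / 2). assert (Hz0 : 0 < z0 < 1) by (unfold z0; lra).
  destruct (H z0 Hz0) as [Hu0 [Hv0 _]].
  set (Mu := Series (fun n => Rabs (u (S N + n)%nat * global_block (c + INR (S N + n)) z0))).
  set (Mv := Series (fun n => Rabs (v n * global_block (c' + INR n) z0))).
  assert (Hut : ex_series (fun n => Rabs (u (S N + n)%nat * global_block (c + INR (S N + n)) z0))).
  { apply (ex_series_incr_n (fun n => Rabs (u n * global_block (c + INR n) z0))); assumption. }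
  assert (HMu : 0 <= Mu).
  { unfold Mu. rewrite <- (Rmult_0_l (Series (fun _ => 0))), <- Series_scal_l.
    apply Series_le; [|assumption]. intros n; split; [lra|]. rewrite Rmult_0_l; apply Rabs_pos. }
  assert (HMv : 0 <= Mv).
  { unfold Mv. rewrite <- (Rmult_0_l (Series (fun _ => 0))), <- Series_scal_l.
    apply Series_le; [|assumption]. intros n; split; [lra|]. rewrite Rmult_0_l; apply Rabs_pos. }
  assert (Key : Rabs (u N) * Rpower z0 (c + INR N) <= 0).
  { apply (Rpower_dominated _ (Mu + Mv) (c + INR N) e2); [assumption|lra|].
    intros w Hw.
    assert (Hzw : 0 < z0 * w < 1) by nra.
    destruct (H _ Hzw) as [Hu1 [Hv1 HS]].
    rewrite (Series_incr_n _ (S N)) in HS by (try lia; apply ex_series_Rabs; assumption).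
    simpl pred in HS.
    assert (E : sum_f_R0 (fun n => u n * global_block (c + INR n) (z0 * w)) N
      = u N * global_block (c + INR N) (z0 * w)).
    { destruct N as [|N1]; [reflexivity|]. cbn [sum_f_R0].
      rewrite (sum_eq_R0 _ N1); [ring|]. intros n Hn. rewrite Hu by lia. ring. }
    rewrite E in HS.
    assert (Hn : forall k, 0 <= INR k) by apply pos_INR.
    assert (Tu : Rabs (Series (fun n => u (S N + n)%nat * global_block (c + INR (S N + n)) (z0 * w)))
      <= Rpower w e2 * Mu).
    { apply (tail_decay (fun n => c + INR (S N + n)) (fun n => u (S N + n)%nat)); try assumption.
      - intros n; specialize (Hn (S N + n)%nat); lra.
      - intros n; right. apply Rle_trans with (c + INR (S N)); [apply Rmin_l|].
        apply Rplus_le_compat_l, le_INR; lia. }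
    assert (Tv : Rabs (Series (fun n => v n * global_block (c' + INR n) (z0 * w))) <= Rpower w e2 * Mv).
    { apply (tail_decay (fun n => c' + INR n) v); try assumption.
      - intros n; specialize (Hn n); lra.
      - intros n; destruct (Nat.lt_ge_cases n N') as [Hl|Hg]; [left; apply Hv; assumption|right].
        apply Rle_trans with (c' + INR N'); [apply Rmin_r|]. apply Rplus_le_compat_l, le_INR; assumption. }
    assert (Hp : 0 <= c + INR N) by (specialize (Hn N); lra).
    pose proof (global_block_ge (c + INR N) (z0 * w) Hp Hzw) as Hge.
    rewrite <- Rpower_mult_distr in Hge by lra.
    apply Rle_trans with (Rabs (u N) * global_block (c + INR N) (z0 * w)).
    { rewrite Rmult_assoc. apply Rmult_le_compat_l; [apply Rabs_pos|assumption]. }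
    pose proof (global_block_pos (c + INR N) (z0 * w) Hp Hzw) as Hgp.
    rewrite <- (Rabs_pos_eq (global_block (c + INR N) (z0 * w))) by lra. rewrite <- Rabs_mult.
    set (X := Series (fun n => u (S N + n)%nat * global_block (c + INR (S N + n)) (z0 * w))) in *.
    set (Y := Series (fun n => v n * global_block (c' + INR n) (z0 * w))) in *.
    replace (u N * global_block (c + INR N) (z0 * w)) with (- (X + Y)) by lra.
    rewrite Rabs_Ropp. pose proof (Rabs_triang X Y). lra. }
  assert (0 < Rpower z0 (c + INR N)) by apply exp_pos.
  pose proof (Rabs_pos (u N)).
  destruct (Req_dec (u N) 0) as [|Hne]; [assumption|].
  pose proof (Rabs_pos_lt _ Hne). nra.
Qed.

(** The exponents interlace, n < h + n < n + 1, so coefficients are removed in the order x_0, y_0,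
    x_1, y_1, and so on. *)
Lemma block_series_unique (h : R) (x y : nat -> R) : 0 < h < 1 ->
  (forall z, 0 < z < 1 ->
    ex_series (fun n => Rabs (x n * global_block (INR n) z))
    /\ ex_series (fun n => Rabs (y n * global_block (h + INR n) z))
    /\ Series (fun n => x n * global_block (INR n) z)
       + Series (fun n => y n * global_block (h + INR n) z) = 0) ->
  forall n, x n = 0 /\ y n = 0.
Proof.
  intros Hh H.
  assert (H' : forall z, 0 < z < 1 ->
    ex_series (fun n => Rabs (x n * global_block (0 + INR n) z))
    /\ ex_series (fun n => Rabs (y n * global_block (h + INR n) z))
    /\ Series (fun n => x n * global_block (0 + INR n) z)
       + Series (fun n => y n * global_block (h + INR n) z) = 0).
  { intros z Hz. destruct (H z Hz) as [H1 [H2 H3]]. split; [|split; [assumption|]].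
    - eapply ex_series_ext; [|exact H1]. intros n; cbv beta. rewrite Rplus_0_l; reflexivity.
    - etransitivity; [|exact H3]. f_equal. apply Series_ext; intros n. rewrite Rplus_0_l; reflexivity. }
  intros n. induction n as [n IH] using (well_founded_induction lt_wf).
  assert (Hx : x n = 0).
  { apply (leading_coef_zero 0 h n n x y); try lra; try (intros; apply IH; assumption). exact H'. }
  split; [assumption|].
  apply (leading_coef_zero h 0 n (S n) y x); try lra.
  - rewrite S_INR; lra.
  - intros; apply IH; assumption.
  - intros k Hk. destruct (Nat.eq_dec k n) as [->|Hne]; [assumption|apply IH; lia].
  - intros z Hz. destruct (H' z Hz) as [H1 [H2 H3]]. repeat split; try assumption. lra.
Qed.

Lemma is_double_series_minus a b c s t :
  (forall n k, c n k = a n k - b n k) ->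
  is_double_series a s -> is_double_series b t -> is_double_series c (s - t).
Proof.
  intros Hc [Ha1 [Ha2 Ha3]] [Hb1 [Hb2 Hb3]].
  assert (Hle : forall n k, Rabs (c n k) <= Rabs (a n k) + Rabs (b n k)).
  { intros n k. rewrite Hc. unfold Rminus. rewrite <- (Rabs_Ropp (b n k)). apply Rabs_triang. }
  assert (Hsum : forall n, ex_series (fun k => Rabs (a n k) + Rabs (b n k))).
  { intros n. apply (ex_series_plus (fun k => Rabs (a n k)) (fun k => Rabs (b n k))); auto. }
  assert (Hd : forall n, ex_series (fun k => Rabs (c n k))).
  { intros n. apply (ex_series_Rabs_le _ _) with (2 := Hsum n). intros k.
    rewrite Rabs_Rabsolu. apply Hle. }
  assert (Hout : forall a', (forall n, ex_series (fun k => Rabs (a' n k))) ->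
    ex_series (fun n => Series (fun k => Rabs (a' n k))) -> ex_series (fun n => Series (a' n))).
  { intros a' Hc1 Hc2. apply (ex_series_Rabs_le _ _) with (2 := Hc2). intros n.
    apply Series_Rabs, Hc1. }
  split; [assumption|split].
  - assert (Hsum2 : ex_series (fun n => Series (fun k => Rabs (a n k)) + Series (fun k => Rabs (b n k)))).
    { apply (ex_series_plus (fun n => Series (fun k => Rabs (a n k))) (fun n => Series (fun k => Rabs (b n k))));
      assumption. }
    apply (ex_series_Rabs_le _ _) with (2 := Hsum2). intros n.
    rewrite <- Series_plus by auto.
    rewrite Rabs_pos_eq.
    + apply Series_le; [|apply Hsum]. intros k; split; [apply Rabs_pos|apply Hle].
    + rewrite <- (Rmult_0_l (Series (fun _ => 0))), <- Series_scal_l.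
      apply Series_le; [|apply Hd]. intros k; split; [lra|]. rewrite Rmult_0_l; apply Rabs_pos.
  - rewrite <- Ha3, <- Hb3, <- Series_minus by auto.
    apply Series_ext; intros n. rewrite <- Series_minus by (apply ex_series_Rabs; auto).
    apply Series_ext; intros k; apply Hc.
Qed.

Lemma double_series_rows (e f : nat -> R) (c : nat -> nat -> R) z zb s :
  (forall n, 0 <= e n) -> 0 < z < 1 ->
  is_double_series (fun n k => c n k * (global_block (e n) z * global_block (f k) zb)) s ->
  let row n := Series (fun k => c n k * global_block (f k) zb) in
  (forall n, ex_series (fun k => Rabs (c n k * global_block (f k) zb)))
  /\ ex_series (fun n => Rabs (row n * global_block (e n) z))
  /\ Series (fun n => row n * global_block (e n) z) = s.
Proof.
  intros He Hz [H1 [H2 H3]] row.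
  assert (Hp : forall n, 0 < global_block (e n) z) by (intros; apply global_block_pos; auto).
  assert (Hrow : forall n, Series (fun k => c n k * (global_block (e n) z * global_block (f k) zb))
    = row n * global_block (e n) z).
  { intros n. unfold row. rewrite Rmult_comm, <- Series_scal_l. apply Series_ext; intros; ring. }
  split; [|split].
  - intros n. specialize (H1 n). apply (ex_series_scal (/ global_block (e n) z)) in H1.
    eapply ex_series_ext; [|exact H1]. intros k. unfold scal; simpl; unfold mult; simpl.
    rewrite !Rabs_mult, (Rabs_pos_eq (global_block (e n) z)) by (apply Rlt_le, Hp).
    field. apply Rgt_not_eq, Hp.
  - apply (ex_series_Rabs_le _ _) with (2 := H2). intros n.
    rewrite Rabs_Rabsolu, <- Hrow. apply Series_Rabs, H1.
  - rewrite <- H3. apply Series_ext; intros n. symmetry; apply Hrow.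
Qed.

Lemma block_expansion_unique h F p q p' q' : 0 < h < 1 ->
  block_expansion h F p q -> block_expansion h F p' q' ->
  forall n k, p' n k = p n k /\ q' n k = q n k.
Proof.
  intros Hh H H'.
  set (x := fun n k => p' n k - p n k). set (y := fun n k => q' n k - q n k).
  assert (HD : forall z zb, 0 < z < 1 -> 0 < zb < 1 -> exists s t,
    is_double_series (fun n k => x n k * (global_block (INR n) z * global_block (INR k) zb)) s /\
    is_double_series (fun n k => y n k * (global_block (h + INR n) z * global_block (h + INR k) zb)) t /\
    s + t = 0).
  { intros z zb Hz Hzb.
    destruct (H z zb Hz Hzb) as [s [t [Hs [Ht E]]]].
    destruct (H' z zb Hz Hzb) as [s' [t' [Hs' [Ht' E']]]].
    exists (s' - s), (t' - t). split; [|split; [|lra]].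
    - eapply is_double_series_minus; [|exact Hs'|exact Hs]. intros; unfold x; ring.
    - eapply is_double_series_minus; [|exact Ht'|exact Ht]. intros; unfold y; ring. }
  assert (He : forall n, 0 <= h + INR n) by (intros n; pose proof (pos_INR n); lra).
  (* For fixed zb the row sums are the coefficients of a vanishing one-variable expansion in z. *)
  assert (Hrows : forall zb, 0 < zb < 1 -> forall n,
    Series (fun k => x n k * global_block (INR k) zb) = 0
    /\ Series (fun k => y n k * global_block (h + INR k) zb) = 0).
  { intros zb Hzb.
    apply (block_series_unique h (fun n => Series (fun k => x n k * global_block (INR k) zb))
      (fun n => Series (fun k => y n k * global_block (h + INR k) zb)) Hh).
    intros z Hz. destruct (HD z zb Hz Hzb) as [s [t [Hs [Ht E]]]].
    apply (double_series_rows INR INR) in Hs; [|exact pos_INR|assumption].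
    apply (double_series_rows (fun n => h + INR n) (fun n => h + INR n)) in Ht; [|exact He|assumption].
    destruct Hs as [_ [Hs1 Hs2]]. destruct Ht as [_ [Ht1 Ht2]].
    split; [exact Hs1|split; [exact Ht1|]]. rewrite <- E. exact (f_equal2 Rplus Hs2 Ht2). }
  assert (Habs : forall zb, 0 < zb < 1 -> forall n,
    ex_series (fun k => Rabs (x n k * global_block (INR k) zb))
    /\ ex_series (fun k => Rabs (y n k * global_block (h + INR k) zb))).
  (* Convergence of a row in zb does not involve z; any sample value such as 1/2 yields it. *)
  { intros zb Hzb n. assert (Hz : 0 < / 2 < 1) by lra.
    destruct (HD (/ 2) zb Hz Hzb) as [s [t [Hs [Ht _]]]].
    apply (double_series_rows INR INR) in Hs; [|exact pos_INR|assumption].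
    apply (double_series_rows (fun n => h + INR n) (fun n => h + INR n)) in Ht; [|exact He|assumption].
    split; [apply Hs|apply Ht]. }
  intros n k.
  assert (Hxy : x n k = 0 /\ y n k = 0).
  { apply (block_series_unique h (x n) (y n) Hh). intros zb Hzb.
    destruct (Habs zb Hzb n) as [H1 H2]. destruct (Hrows zb Hzb n) as [E1 E2].
    split; [assumption|split; [assumption|]]. rewrite E1, E2. ring. }
  destruct Hxy as [Ex Ey]. unfold x in Ex. unfold y in Ey. lra.
Qed.

(** * Product expansions, the sign of C, and the conclusion *)

Lemma is_double_series_product (u v : nat -> R) (s t : R) (a : nat -> nat -> R) (c : R) :
  0 <= c -> (forall n, 0 <= u n) -> (forall n, 0 <= v n) ->
  (forall n k, a n k = c * (u n * v k)) ->
  is_series u s -> is_series v t -> is_double_series a (c * (s * t)).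
Proof.
  intros Hc Hu Hv Ha Hs Ht.
  assert (Hpos : forall n k, Rabs (a n k) = a n k).
  { intros n k; apply Rabs_pos_eq. rewrite Ha. repeat apply Rmult_le_pos; auto. }
  assert (Hrow : forall n, is_series (a n) (u n * (c * t))).
  { intros n. apply (is_series_scal (c * u n)) in Ht.
    replace (u n * (c * t)) with (scal (c * u n) t) by (unfold scal; simpl; unfold mult; simpl; ring).
    eapply is_series_ext; [|exact Ht]. intros k. unfold scal; simpl; unfold mult; simpl.
    rewrite Ha; ring. }
  assert (Hser : forall n, Series (fun k => Rabs (a n k)) = u n * (c * t)).
  { intros n. rewrite (Series_ext _ _ (Hpos n)). apply is_series_unique, Hrow. }
  assert (Hall : is_series (fun n => u n * (c * t)) (c * (s * t))).
  { apply (is_series_scal (c * t)) in Hs.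
    replace (c * (s * t)) with (scal (c * t) s) by (unfold scal; simpl; unfold mult; simpl; ring).
    eapply is_series_ext; [|exact Hs]. intros k. unfold scal; simpl; unfold mult; simpl. ring. }
  split; [|split].
  - intros n. eapply ex_series_ext; [|exists (u n * (c * t)); apply Hrow]. intros k; symmetry; apply Hpos.
  - eapply ex_series_ext; [|exists (c * (s * t)); exact Hall]. intros n; symmetry; apply Hser.
  - rewrite <- (is_series_unique _ _ Hall). apply Series_ext; intros n. apply is_series_unique, Hrow.
Qed.

Lemma sparse_block_expansion d s z : hyp_regular d s -> 0 < z < 1 ->
  is_series (fun n => sparse (block_coef ((1 - 2 * d) / 3) s) n * global_block (s + INR n) z)
    (Rpower z s * (Rpower (1 - z) (- d)
      * hyp2F1 (s - 2 * d) (s + (1 - 2 * d) / 3) (2 * s + 2 * ((1 - 2 * d) / 3)) z)).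
Proof.
  intros Hds Hz. eapply is_series_ext; [|exact (is_series_sparse _ _ (virasoro_block_expansion d s z Hds Hz))].
  intros n. unfold sparse. destruct (Nat.even n) eqn:En; [|simpl; ring].
  replace (INR n) with (2 * INR (Nat.div2 n)); [reflexivity|].
  apply Nat.even_spec in En. destruct En as [m ->]. rewrite Nat.div2_double, mult_INR. reflexivity.
Qed.

(* Only weak signs are claimed, so convergence of Euler's limit is irrelevant: an
   infinite limit has real part [0]. *)
Lemma Gamma_nonneg x : 0 < x -> 0 <= Gamma x.
Proof.
  intros Hx. unfold Gamma.
  set (u := fun n => INR (fact n) * Rpower (INR n) x / pochhammer x (S n)).
  assert (H : Rbar_le 0 (Lim_seq u)).
  { rewrite <- (Lim_seq_const 0). apply Lim_seq_le_loc. exists 0%nat. intros n _. unfold u.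
    apply Rdiv_le_0_compat; [|apply pochhammer_pos; assumption].
    apply Rmult_le_pos; [apply pos_INR|apply Rlt_le, exp_pos]. }
  destruct (Lim_seq u); simpl in *; lra.
Qed.

Lemma Gamma_nonpos x : -1 < x < 0 -> Gamma x <= 0.
Proof.
  intros Hx. unfold Gamma.
  set (u := fun n => INR (fact n) * Rpower (INR n) x / pochhammer x (S n)).
  assert (H : Rbar_le (Lim_seq u) 0).
  { rewrite <- (Lim_seq_const 0). apply Lim_seq_le_loc. exists 0%nat. intros n _. unfold u.
    (* For -1 < x < 0 only the first factor x of the denominator is negative. *)
    rewrite pochhammer_Sl.
    assert (0 < pochhammer (x + 1) n) by (apply pochhammer_pos; lra).
    assert (0 <= INR (fact n) * Rpower (INR n) x)
      by (apply Rmult_le_pos; [apply pos_INR|apply Rlt_le, exp_pos]).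
    assert (/ (x * pochhammer (x + 1) n) < 0) by (apply Rinv_lt_0_compat; nra).
    unfold Rdiv; nra. }
  destruct (Lim_seq u); simpl in *; lra.
Qed.

(** The case y = 0 uses [/ 0 = 0]; thus weak signs of [Gamma] suffice for [gamma_ratio]. *)
Lemma Rdiv_nonneg x y : 0 <= x -> 0 <= y -> 0 <= x / y.
Proof.
  intros Hx [Hy|<-]; [apply Rdiv_le_0_compat; assumption|unfold Rdiv; rewrite Rinv_0; lra].
Qed.

Lemma gamma_ratio_nonneg x : 0 < x < 1 -> 0 <= gamma_ratio x.
Proof. intros Hx. apply Rdiv_nonneg; apply Gamma_nonneg; lra. Qed.

Lemma gamma_ratio_nonpos_left x : -1 < x < 0 -> gamma_ratio x <= 0.
Proof.
  intros Hx. unfold gamma_ratio.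
  pose proof (Rdiv_nonneg (- Gamma x) (Gamma (1 - x))) as H.
  pose proof (Gamma_nonpos x Hx). pose proof (Gamma_nonneg (1 - x)).
  unfold Rdiv in *. lra.
Qed.

Lemma gamma_ratio_nonpos_right x : 1 < x < 2 -> gamma_ratio x <= 0.
Proof.
  intros Hx. unfold gamma_ratio.
  pose proof (Rdiv_nonneg (Gamma x) (- Gamma (1 - x))) as H.
  assert (Gamma (1 - x) <= 0) by (apply Gamma_nonpos; lra).
  pose proof (Gamma_nonneg x).
  unfold Rdiv in *. rewrite Rinv_opp in H. lra.
Qed.

Theorem mainTheorem1 (m : R) (hm : 3 < m) :
  let t := m / (m + 1) in
  let Delta := (m - 2) / (2 * (m + 1)) in
  let C := gamma_ratio t * gamma_ratio (3 * t - 1)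
           * gamma_ratio (1 - 2 * t) * gamma_ratio (2 - 2 * t) in
  let h := (1 + 4 * Delta) / 3 in
  exists p q : nat -> nat -> R,
    block_expansion h (four_point Delta C) p q
    /\ (forall p' q' : nat -> nat -> R,
          block_expansion h (four_point Delta C) p' q' ->
          forall n k : nat, p' n k = p n k /\ q' n k = q n k)
    /\ (forall n k : nat, 0 <= p n k /\ 0 <= q n k).
Proof.
  intros t Delta C h.
  assert (Ht : 3 / 4 < t < 1).
  { assert (E : t = 1 - / (m + 1)) by (unfold t; field; lra).
    assert (0 < / (m + 1) < / 4) by (split; [apply Rinv_0_lt_compat|apply Rinv_lt_contravar]; lra).
    lra. }
  assert (HDelta : / 8 < Delta < / 2).
  { replace Delta with ((3 * t - 2) / 2) by (unfold Delta, t; field; lra). lra. }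
  (* From 3/4 < t < 1: t and 2 - 2t lie in (0, 1), 3t - 1 in (1, 2) and 1 - 2t in (-1, 0), so
     exactly the two middle factors are non-positive by the sign lemmas. *)
  assert (HC : 0 <= C).
  { unfold C.
    pose proof (gamma_ratio_nonneg t ltac:(lra)).
    pose proof (gamma_ratio_nonneg (2 - 2 * t) ltac:(lra)).
    pose proof (gamma_ratio_nonpos_right (3 * t - 1) ltac:(lra)).
    pose proof (gamma_ratio_nonpos_left (1 - 2 * t) ltac:(lra)).
    apply Rmult_le_pos; [|assumption].
    rewrite Rmult_assoc. apply Rmult_le_pos; [assumption|nra]. }
  clearbody t Delta C.
  set (b := (1 - 2 * Delta) / 3).
  assert (R0 : hyp_regular Delta 0) by (split; [lra|left; reflexivity]).
  assert (Rh : hyp_regular Delta h) by (split; [lra|right; reflexivity]).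
  set (a0 := sparse (block_coef b 0)). set (a1 := sparse (block_coef b h)).
  assert (Hpos : forall s n, hyp_regular Delta s -> 0 <= sparse (block_coef b s) n).
  { intros s n Hs. unfold sparse. destruct (Nat.even n); [|lra].
    apply Rlt_le, block_coef_pos, (hyp_regular_params Delta s Hs). }
  exists (fun n k => a0 n * a0 k), (fun n k => C * (a1 n * a1 k)).
  assert (Hexp : block_expansion h (four_point Delta C)
    (fun n k => a0 n * a0 k) (fun n k => C * (a1 n * a1 k))).
  { assert (E0 : forall z, 0 < z < 1 ->
      is_series (fun n => a0 n * global_block (INR n) z) (G11 Delta z)).
    { intros z Hz. pose proof (sparse_block_expansion Delta 0 z R0 Hz) as H.
      rewrite Rpower_O, Rmult_1_l in H by lra. unfold G11.
      replace (- 2 * Delta) with (0 - 2 * Delta) by ring.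
      replace ((1 - 2 * Delta) / 3) with (0 + (1 - 2 * Delta) / 3) by ring.
      replace ((2 - 4 * Delta) / 3) with (2 * 0 + 2 * ((1 - 2 * Delta) / 3)) by field.
      eapply is_series_ext; [|exact H]. intros n; cbv beta. rewrite Rplus_0_l; reflexivity. }
    assert (E1 : forall z, 0 < z < 1 ->
      is_series (fun n => a1 n * global_block (h + INR n) z) (G13 Delta z)).
    { intros z Hz. pose proof (sparse_block_expansion Delta h z Rh Hz) as H.
      unfold G13. fold h. rewrite Rmult_assoc.
      replace ((1 - 2 * Delta) / 3) with (h - 2 * Delta) at 1 by (unfold h; field).
      replace ((2 + 2 * Delta) / 3) with (h + (1 - 2 * Delta) / 3) by (unfold h; field).
      replace ((4 + 4 * Delta) / 3) with (2 * h + 2 * ((1 - 2 * Delta) / 3)) by (unfold h; field).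
      exact H. }
    intros z zb Hz Hzb.
    assert (Hh : forall n, 0 <= h + INR n) by (intros n; pose proof (pos_INR n); unfold h; lra).
    (* The factor 1 matches the constant [c] of [is_double_series_product]. *)
    exists (1 * (G11 Delta z * G11 Delta zb)), (C * (G13 Delta z * G13 Delta zb)).
    split; [|split; [|unfold four_point; ring]].
    - eapply is_double_series_product; [lra| | | |exact (E0 z Hz)|exact (E0 zb Hzb)].
      1,2: intros n; apply Rmult_le_pos; [apply Hpos, R0|apply Rlt_le, global_block_pos; [apply pos_INR|assumption]].
      intros n k; cbv beta; ring.
    - eapply is_double_series_product; [exact HC| | | |exact (E1 z Hz)|exact (E1 zb Hzb)].
      1,2: intros n; apply Rmult_le_pos; [apply Hpos, Rh|apply Rlt_le, global_block_pos; [apply Hh|assumption]].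
      intros n k; cbv beta; ring. }
  split; [exact Hexp|split].
  - intros p' q' H'. apply (block_expansion_unique h (four_point Delta C)); [unfold h; lra|exact Hexp|exact H'].
  - intros n k. split; [apply Rmult_le_pos; apply Hpos, R0|].
    apply Rmult_le_pos; [exact HC|apply Rmult_le_pos; apply Hpos, Rh].
Qed.
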